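(* The algebra $S(\pi)$ is isomorphic to the quotient algebra $U/I$, where $I$ is the ideal of $U$ consisting of all elements of $U$ which annihilate every $U$-module belonging to $\pi$. Thus $S(\pi)$ is a generalized Schur algebra in the sense of Donkin.
   Context: Root data. Let $(a_{ij})_{1\le i,j\le n}$ be a Cartan matrix of finite type (not assumed indecomposable): integers with $a_{ii}=2$, $a_{ij}\le 0$ for $i\ne j$, and there are $d_i\in\{1,2,3\}$ with $(d_ia_{ij})$ symmetric and positive definite. Let $\mathfrak{g}$ be the corresponding semisimple Lie algebra over $\mathbb{Q}$, $\mathfrak{h}$ its Cartan subalgebra, $\alpha_i\in\mathfrak{h}^*$ the simple roots, $\alpha_i^\vee\in\mathfrak{h}$ the simple coroots, $\langle\alpha_i^\vee,\alpha_j\rangle=a_{ij}$, $W$ the Weyl group. Let $X=\{\lambda\in\mathfrak{h}^*\mid\langle\alpha_i^\vee,\lambda\rangle\in\mathbb{Z}\ \forall i\}$, $X^+=\{\lambda\in X\mid\langle\alpha_i^\vee,\lambda\rangle\ge0\ \forall i\}$, and write $\lambda\le\mu$ if $\mu-\lambda\in\sum_i\mathbb{N}\alpha_i$. Let $\pi\subset X^+$ be a finite saturated set, i.e. $\mu\in\pi$, $\lambda\in X^+$, $\lambda\le\mu$ imply $\lambda\in\pi$. Let $W\pi=\{w\mu\mid w\in W,\mu\in\pi\}$. The algebra $S(\pi)$. It is the associative unital $\mathbb{Q}$-algebra with generators $e_i,f_i$ ($1\le i\le n$), $1_\lambda$ ($\lambda\in W\pi$) and relations: $1_\lambda1_\mu=\delta_{\lambda\mu}1_\lambda$,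 $\sum_{\lambda\in W\pi}1_\lambda=1$; $e_if_j-f_je_i=\delta_{ij}\sum_{\lambda\in W\pi}\langle\alpha_i^\vee,\lambda\rangle1_\lambda$; $e_i1_\lambda=1_{\lambda+\alpha_i}e_i$ if $\lambda+\alpha_i\in W\pi$ and $e_i1_\lambda=0$ otherwise; $f_i1_\lambda=1_{\lambda-\alpha_i}f_i$ if $\lambda-\alpha_i\in W\pi$ and $f_i1_\lambda=0$ otherwise; $1_\lambda e_i=e_i1_{\lambda-\alpha_i}$ if $\lambda-\alpha_i\in W\pi$ and $1_\lambda e_i=0$ otherwise; $1_\lambda f_i=f_i1_{\lambda+\alpha_i}$ if $\lambda+\alpha_i\in W\pi$ and $1_\lambda f_i=0$ otherwise; and for $i\ne j$ the Serre relations $\sum_{s=0}^{1-a_{ij}}(-1)^s\binom{1-a_{ij}}{s}e_i^{1-a_{ij}-s}e_je_i^s=0$ and the same with $f$ in place of $e$. The algebra $U$ (the universal enveloping algebra of $\mathfrak{g}$) is the associative unital $\mathbb{Q}$-algebra with generators $e_i,f_i,h_i$ ($1\le i\le n$) and relations $h_ih_j=h_jh_i$, $e_if_j-f_je_i=\delta_{ij}h_i$, $h_ie_j-e_jh_i=a_{ij}e_j$, $h_if_j-f_jh_i=-a_{ij}f_j$, and the same Serre relations for $i\ne j$. For $\lambda\in X^+$, $L_\lambda$ is the simple $U$-module of highest weight $\lambda$. A (finite-dimensional) $U$-module belongs to $\pi$ if all its composition factors are of the form $L_\lambda$ with $\lambda\in\pi$. The generalized Schur algebra in Donkin's sense attached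 to $\pi$ is the quotient of $U$ by the ideal of all elements annihilating every $U$-module belonging to $\pi$. *)

(* Defs.v *)
From HB Require Import structures.
From mathcomp Require Import all_boot all_order all_algebra generic_quotient.
From mathcomp Require Import ring_quotient.
From mathcomp.classical Require Import boolp classical_sets cardinality fsbigop.
From mathcomp.multinomials Require Import monalg.

Set Implicit Arguments.
Unset Strict Implicit.
Unset Printing Implicit Defensive.

Import Order.TTheory GRing.Theory Num.Theory.
Local Open Scope classical_set_scope.
Local Open Scope ring_scope.
Local Open Scope quotient_scope.

(* Associative unital Q-algebras, given by their structure map from Q to the
   centre.  The library's [algType rat] forces 1 != 0, but [Salg] and
   [generalized_schur_alg] are the zero ring when the set of weights is empty. *)
HB.mixin Record isRatAlgebra A of GRing.PzRing A := {
  in_rat : rat -> A;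
  in_rat_zmod : zmod_morphism in_rat;
  in_rat_monoid : monoid_morphism in_rat;
  in_ratC : forall (a : rat) (x : A), in_rat a * x = x * in_rat a
}.

#[short(type="ratAlgType")]
HB.structure Definition RatAlgebra := {A of GRing.PzRing A & isRatAlgebra A}.

HB.instance Definition _ (A : ratAlgType) :=
  GRing.isZmodMorphism.Build rat A in_rat in_rat_zmod.
HB.instance Definition _ (A : ratAlgType) :=
  GRing.isMonoidMorphism.Build rat A in_rat in_rat_monoid.

Definition alg_isomorphic (A B : ratAlgType) : Prop :=
  exists phi : {rmorphism A -> B},
    (forall a : rat, phi (in_rat a) = in_rat a) /\ bijective phi.

(* Two-sided ideals, not necessarily proper, and the corresponding quotients:
   the library only has quotients of commutative rings by proper ideals. *)
HB.mixin Record isTwoSided (A : pzRingType) (S : A -> bool) := {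
  twosidedMl : forall x y, S y -> S (x * y);
  twosidedMr : forall x y, S x -> S (x * y)
}.

#[short(type="idealType")]
HB.structure Definition TwoSidedIdeal (A : pzRingType) :=
  {S of GRing.ZmodClosed A S & isTwoSided A S}.

Section IdealTheory.
Variables (A : pzRingType) (I : idealType A).

Lemma ideal_Ml (x y : A) : y \in I -> x * y \in I.
Proof. exact: twosidedMl. Qed.

Lemma ideal_Mr (x y : A) : x \in I -> x * y \in I.
Proof. exact: twosidedMr. Qed.

End IdealTheory.

Section AlgebraQuotient.
Variables (A : ratAlgType) (I : idealType A).

Definition alg_quot : Type := Quotient.quot I.

HB.instance Definition _ := GRing.Zmodule.on alg_quot.
HB.instance Definition _ := EqQuotient.on alg_quot.

Local Notation pq := (\pi_(alg_quot)).

Lemma alg_quotW (P : alg_quot -> Prop) :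
  (forall x, P (pq x)) -> forall x, P x.
Proof. exact: quotW. Qed.

Lemma alg_quotP (x y : A) : reflect (pq x = pq y) (x - y \in I).
Proof. by rewrite Quotient.idealrBE; exact: eqP. Qed.

Lemma alg_quotD (x y : A) : pq (x + y) = pq x + pq y.
Proof. exact: Quotient.pi_add. Qed.

Lemma alg_quotB (x y : A) : pq (x - y) = pq x - pq y.
Proof. by rewrite alg_quotD; congr (_ + _); exact: Quotient.pi_opp. Qed.

Definition alg_quot_one : alg_quot := pq 1.
Definition alg_quot_mul (x y : alg_quot) : alg_quot := pq (repr x * repr y).
Definition alg_quot_in_rat (a : rat) : alg_quot := pq (in_rat a).

Lemma alg_quot_mulE (x y : A) : alg_quot_mul (pq x) (pq y) = pq (x * y).
Proof.
apply/alg_quotP.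
have hx : repr (pq x) - x \in I by apply/alg_quotP; rewrite reprK.
have hy : repr (pq y) - y \in I by apply/alg_quotP; rewrite reprK.
set x' := repr _ in hx *; set y' := repr _ in hy *.
have -> : x' * y' - x * y = x' * (y' - y) + (x' - x) * y.
  by rewrite mulrBr mulrBl addrA subrK.
apply: rpredD; first exact: ideal_Ml.
exact: ideal_Mr.
Qed.

Lemma alg_quot_mulA : associative alg_quot_mul.
Proof.
move=> x y z; elim/alg_quotW: x => x; elim/alg_quotW: y => y; elim/alg_quotW: z => z.
by rewrite !alg_quot_mulE mulrA.
Qed.

Lemma alg_quot_mul1 : left_id alg_quot_one alg_quot_mul.
Proof. by move=> x; elim/alg_quotW: x => x; rewrite /alg_quot_one alg_quot_mulE mul1r. Qed.

Lemma alg_quot_mulr1 : right_id alg_quot_one alg_quot_mul.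
Proof. by move=> x; elim/alg_quotW: x => x; rewrite /alg_quot_one alg_quot_mulE mulr1. Qed.

Lemma alg_quot_mulDl : left_distributive alg_quot_mul +%R.
Proof.
move=> x y z; elim/alg_quotW: x => x; elim/alg_quotW: y => y; elim/alg_quotW: z => z.
by rewrite -alg_quotD !alg_quot_mulE -alg_quotD mulrDl.
Qed.

Lemma alg_quot_mulDr : right_distributive alg_quot_mul +%R.
Proof.
move=> x y z; elim/alg_quotW: x => x; elim/alg_quotW: y => y; elim/alg_quotW: z => z.
by rewrite -alg_quotD !alg_quot_mulE -alg_quotD mulrDr.
Qed.

HB.instance Definition _ := GRing.Zmodule_isPzRing.Build alg_quot
  alg_quot_mulA alg_quot_mul1 alg_quot_mulr1 alg_quot_mulDl alg_quot_mulDr.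

Lemma alg_quot_in_rat_zmod : zmod_morphism alg_quot_in_rat.
Proof. by move=> a b; rewrite /alg_quot_in_rat rmorphB alg_quotB. Qed.

Lemma alg_quot_in_rat_monoid : monoid_morphism alg_quot_in_rat.
Proof.
split=> [|a b]; first by rewrite /alg_quot_in_rat rmorph1.
by rewrite /alg_quot_in_rat rmorphM -alg_quot_mulE.
Qed.

Lemma alg_quot_in_ratC (a : rat) (x : alg_quot) :
  alg_quot_in_rat a * x = x * alg_quot_in_rat a.
Proof.
elim/alg_quotW: x => x; rewrite /alg_quot_in_rat.
by rewrite [LHS]alg_quot_mulE [RHS]alg_quot_mulE in_ratC.
Qed.

HB.instance Definition _ := isRatAlgebra.Build alg_quot
  alg_quot_in_rat_zmod alg_quot_in_rat_monoid alg_quot_in_ratC.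

Definition alg_pi (x : A) : alg_quot := pq x.

Lemma alg_pi_zmod : zmod_morphism alg_pi.
Proof. exact: alg_quotB. Qed.

Lemma alg_pi_monoid : monoid_morphism alg_pi.
Proof. by split=> [|x y]; [|rewrite [RHS]alg_quot_mulE]. Qed.

HB.instance Definition _ :=
  GRing.isZmodMorphism.Build A alg_quot alg_pi alg_pi_zmod.
HB.instance Definition _ :=
  GRing.isMonoidMorphism.Build A alg_quot alg_pi alg_pi_monoid.

Lemma alg_piP (x y : A) : reflect (alg_pi x = alg_pi y) (x - y \in I).
Proof. exact: alg_quotP. Qed.

End AlgebraQuotient.

Section IdealGenerated.
Variables (A : pzRingType) (R : set A).

Definition ideal_gen : {pred A} :=
  fun x => `[< forall I : idealType A, (forall r, R r -> r \in I) -> x \in I >].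

Lemma ideal_gen_zmod : zmod_closed ideal_gen.
Proof.
split; first by apply/asboolP => I _; exact: rpred0.
move=> x y /asboolP hx /asboolP hy; apply/asboolP => I hI.
by apply: rpredB; [exact: hx | exact: hy].
Qed.

Lemma ideal_genMl (x y : A) : ideal_gen y -> ideal_gen (x * y).
Proof.
move=> /asboolP hy; apply/asboolP => I hI.
by apply: ideal_Ml; exact: hy.
Qed.

Lemma ideal_genMr (x y : A) : ideal_gen x -> ideal_gen (x * y).
Proof.
move=> /asboolP hx; apply/asboolP => I hI.
by apply: ideal_Mr; exact: hx.
Qed.

HB.instance Definition _ := GRing.isZmodClosed.Build A ideal_gen ideal_gen_zmod.
HB.instance Definition _ :=
  isTwoSided.Build A ideal_gen ideal_genMl ideal_genMr.

End IdealGenerated.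

(* The free associative Q-algebra on a set G of generators: the monoid algebra
   of the free monoid on G. *)
Section FreeAlgebra.
Variable G : choiceType.

Definition free_alg : Type := {malg rat[{fmonom G}]}.

HB.instance Definition _ := GRing.PzRing.on free_alg.

Definition free_in_rat : rat -> free_alg := mkmalgU mone.
Definition free_gen (g : G) : free_alg := << fmu g >>.

Lemma free_in_rat_zmod : zmod_morphism free_in_rat.
Proof. by move=> a b; exact: monalgUB. Qed.

Lemma free_in_rat_monoid : monoid_morphism free_in_rat.
Proof. by split=> [|a b]; [exact: mpolyC1E | exact: mpolyCM]. Qed.

Lemma free_in_ratC (a : rat) (x : free_alg) :
  free_in_rat a * x = x * free_in_rat a.
Proof.
rewrite (monalgE x) mulr_sumr mulr_suml; apply: eq_bigr => m _.
rewrite [LHS]fgmulUU [RHS]fgmulUU.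
by rewrite mul1m mulm1 mulrC.
Qed.

HB.instance Definition _ := isRatAlgebra.Build free_alg
  free_in_rat_zmod free_in_rat_monoid free_in_ratC.

End FreeAlgebra.

(* The algebra with generators G and relations x = y for all x, y such that
   R x y. *)
Section Presentation.
Variables (G : choiceType) (R : free_alg G -> free_alg G -> Prop).

Definition relation_ideal : {pred free_alg G} :=
  ideal_gen [set z | exists x y, R x y /\ z = x - y].

HB.instance Definition _ := TwoSidedIdeal.on relation_ideal.

Definition presented_alg : ratAlgType := alg_quot relation_ideal.

Definition pgen (g : G) : presented_alg := alg_pi relation_ideal (free_gen g).

End Presentation.

Section Submodule.
Variables (U : pzRingType) (V : lmodType U) (N : submodClosed V).

Record submod : predArgType :=
  SubMod { submod_val : V; submod_valP : submod_val \in N }.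

HB.instance Definition _ := [isSub for submod_val].
HB.instance Definition _ := [Choice of submod by <:].
HB.instance Definition _ := [SubChoice_isSubLmodule of submod by <:].

End Submodule.

Section QuotientModule.
Variables (U : pzRingType) (V : lmodType U) (M : submodClosed V).

(* [submodClosed] does not inherit from [zmodClosed]. *)
Definition submod_pred : {pred V} := M.

HB.instance Definition _ := GRing.isZmodClosed.Build V submod_pred
  (GRing.subsemimod_closedB (GRing.subsemimodClosedP M)).

Definition quotmod : Type := Quotient.quot submod_pred.

HB.instance Definition _ := GRing.Zmodule.on quotmod.
HB.instance Definition _ := EqQuotient.on quotmod.

Local Notation pq := (\pi_(quotmod)).

Lemma quotmodW (P : quotmod -> Prop) :
  (forall x, P (pq x)) -> forall x, P x.
Proof. exact: quotW. Qed.

Lemma quotmodP (x y : V) : reflect (pq x = pq y) (x - y \in M).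
Proof.
by rewrite -[_ \in M]/(_ \in submod_pred) Quotient.idealrBE; exact: eqP.
Qed.

Lemma quotmodD (x y : V) : pq (x + y) = pq x + pq y.
Proof. exact: Quotient.pi_add. Qed.

Definition quotmod_scale (a : U) (x : quotmod) : quotmod := pq (a *: repr x).

Lemma quotmod_scaleE a (x : V) : quotmod_scale a (pq x) = pq (a *: x).
Proof.
apply/quotmodP; rewrite -scalerBr; apply: rpredZ.
by apply/quotmodP; rewrite reprK.
Qed.

Lemma quotmod_scaleA a b (x : quotmod) :
  quotmod_scale a (quotmod_scale b x) = quotmod_scale (a * b) x.
Proof. by elim/quotmodW: x => x; rewrite !quotmod_scaleE scalerA. Qed.

Lemma quotmod_scale1 : left_id 1 quotmod_scale.
Proof. by move=> x; elim/quotmodW: x => x; rewrite quotmod_scaleE scale1r. Qed.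

Lemma quotmod_scaleDr : right_distributive quotmod_scale +%R.
Proof.
move=> a x y; elim/quotmodW: x => x; elim/quotmodW: y => y.
by rewrite -quotmodD !quotmod_scaleE -quotmodD scalerDr.
Qed.

Lemma quotmod_scaleDl (x : quotmod) :
  {morph quotmod_scale^~ x : a b / a + b}.
Proof.
by move=> a b; elim/quotmodW: x => x /=; rewrite !quotmod_scaleE -quotmodD scalerDl.
Qed.

HB.instance Definition _ := GRing.Zmodule_isLmodule.Build U quotmod
  quotmod_scaleA quotmod_scale1 quotmod_scaleDr quotmod_scaleDl.

End QuotientModule.

Section Subquotient.
Variables (U : pzRingType) (V : lmodType U) (N M : submodClosed V).

Definition submod_trace : {pred submod N} := fun x => submod_val x \in M.

Lemma submod_trace_closed : GRing.subsemimod_closed submod_trace.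
Proof.
split; [split|]; rewrite /submod_trace.
- by rewrite [_ \in _]rpred0.
- by move=> x y hx hy; apply: rpredD.
- by move=> a x hx; apply: rpredZ.
Qed.

HB.instance Definition _ :=
  GRing.isSubmodClosed.Build U (submod N) submod_trace submod_trace_closed.

(* The quotient module N / (N :&: M), that is N / M when M is contained in N. *)
Definition factor_mod : lmodType U := quotmod submod_trace.

End Subquotient.

Section ModuleNotions.
Variable U : pzRingType.

Definition simple_module (V : lmodType U) : Prop :=
  (exists v : V, v != 0) /\
  forall N : submodClosed V, (forall v, v \in N -> v = 0) \/ forall v, v \in N.

Record composition_series (V : lmodType U) := CompositionSeries {
  cs_length : nat;
  cs_term : nat -> submodClosed V;
  cs_bottom : forall v, v \in cs_term 0 <-> v = 0;
  cs_top : forall v, v \in cs_term cs_length;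
  cs_incl : forall i, (i < cs_length)%N ->
    forall v, v \in cs_term i -> v \in cs_term i.+1;
  cs_simple : forall i, (i < cs_length)%N ->
    simple_module (factor_mod (cs_term i.+1) (cs_term i))
}.

End ModuleNotions.

Definition finite_dimensional (U : ratAlgType) (V : lmodType U) : Prop :=
  exists s : seq V, forall v, exists c : nat -> rat,
    v = \sum_(i < size s) (in_rat (c i) : U) *: s`_i.

(* The weight lattice X: the simple coroots form a basis of the Cartan
   subalgebra, so lambda in X is given by its integer coordinates
   lam 0 i = <alpha_i^vee, lambda>. *)
Notation weight n := 'rV[int]_n.

Section RootData.
Variables (n : nat) (A : 'M[int]_n).

Definition cartan_finite_type : Prop :=
  [/\ forall i, A i i = 2,
      forall i j, i != j -> A i j <= 0 &
      exists d : 'I_n -> int,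
        [/\ forall i, d i \in [:: 1; 2; 3],
            forall i j, d i * A i j = d j * A j i &
            forall x : 'I_n -> rat, (exists i, x i != 0) ->
              0 < \sum_i \sum_j (d i * A i j)%:~R * x i * x j]].

Definition simple_root (j : 'I_n) : weight n := \row_i A i j.

Definition dominant (lam : weight n) : Prop := forall i, 0 <= lam 0 i.

Definition weight_le (lam mu : weight n) : Prop :=
  exists k : 'I_n -> nat, mu - lam = \sum_i simple_root i *+ k i.

Definition saturated (pi : set (weight n)) : Prop :=
  (forall mu, pi mu -> dominant mu) /\
  forall lam mu, pi mu -> dominant lam -> weight_le lam mu -> pi lam.

Definition simple_reflection (i : 'I_n) (lam : weight n) : weight n :=
  lam - lam 0 i *: simple_root i.

(* Simple reflections are involutions, so the group they generate consists of
   their composites. *)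
Inductive weyl : (weight n -> weight n) -> Prop :=
| weyl_id : weyl id
| weyl_comp i w : weyl w -> weyl (simple_reflection i \o w).

Definition weyl_orbits (pi : set (weight n)) : set (weight n) :=
  [set lam | exists w mu, [/\ weyl w, pi mu & lam = w mu]].

Definition serre_sum (R : pzRingType) (x : 'I_n -> R) (i j : 'I_n) : R :=
  let m := `|1 - A i j|%N in
  \sum_(s < m.+1) (-1) ^+ s * 'C(m, s)%:R * (x i ^+ (m - s) * x j * x i ^+ s).

Section EnvelopingAlgebra.

Definition U_gen : choiceType := ('I_n + 'I_n + 'I_n)%type.

Definition free_U_e (i : 'I_n) := @free_gen U_gen (inl (inl i)).
Definition free_U_f (i : 'I_n) := @free_gen U_gen (inl (inr i)).
Definition free_U_h (i : 'I_n) := @free_gen U_gen (inr i).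

Local Notation e := free_U_e.
Local Notation f := free_U_f.
Local Notation h := free_U_h.

Inductive U_rel : free_alg U_gen -> free_alg U_gen -> Prop :=
| U_hh i j : U_rel (h i * h j) (h j * h i)
| U_ef i j : U_rel (e i * f j - f j * e i) (if i == j then h i else 0)
| U_he i j : U_rel (h i * e j - e j * h i) (in_rat (A i j)%:~R * e j)
| U_hf i j : U_rel (h i * f j - f j * h i) (- (in_rat (A i j)%:~R * f j))
| U_serre_e i j : i != j -> U_rel (serre_sum e i j) 0
| U_serre_f i j : i != j -> U_rel (serre_sum f i j) 0.

Definition Ualg : ratAlgType := presented_alg U_rel.

Definition U_e (i : 'I_n) : Ualg := pgen U_rel (inl (inl i)).
Definition U_h (i : 'I_n) : Ualg := pgen U_rel (inr i).

End EnvelopingAlgebra.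

Section SchurPresentation.
Variable pi : set (weight n).

Definition S_gen : choiceType := ('I_n + 'I_n + weyl_orbits pi)%type.

Definition free_S_e (i : 'I_n) := @free_gen S_gen (inl (inl i)).
Definition free_S_f (i : 'I_n) := @free_gen S_gen (inl (inr i)).

(* The generator 1_lam for lam in W pi, and 0 for every other weight. *)
Definition free_S_idem (lam : weight n) : free_alg S_gen :=
  if insub lam is Some x then @free_gen S_gen (inr x) else 0.

Local Notation e := free_S_e.
Local Notation f := free_S_f.
Local Notation idem := free_S_idem.
Local Notation alpha := simple_root.

(* By the convention on [free_S_idem], the right-hand side of the last four
   commutation relations is 0 when the shifted weight is not in W pi.  The set
   W pi is finite, which is what makes the sums over it meaningful. *)
Inductive S_rel : free_alg S_gen -> free_alg S_gen -> Prop :=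
| S_idem lam mu : weyl_orbits pi lam -> weyl_orbits pi mu ->
    S_rel (idem lam * idem mu) (if lam == mu then idem lam else 0)
| S_one : S_rel (\sum_(lam \in weyl_orbits pi) idem lam) 1
| S_ef i j : S_rel (e i * f j - f j * e i)
    (if i == j
     then \sum_(lam \in weyl_orbits pi) in_rat (lam 0 i)%:~R * idem lam
     else 0)
| S_e_idem i lam : weyl_orbits pi lam ->
    S_rel (e i * idem lam) (idem (lam + alpha i) * e i)
| S_f_idem i lam : weyl_orbits pi lam ->
    S_rel (f i * idem lam) (idem (lam - alpha i) * f i)
| S_idem_e i lam : weyl_orbits pi lam ->
    S_rel (idem lam * e i) (e i * idem (lam - alpha i))
| S_idem_f i lam : weyl_orbits pi lam ->
    S_rel (idem lam * f i) (f i * idem (lam + alpha i))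
| S_serre_e i j : i != j -> S_rel (serre_sum e i j) 0
| S_serre_f i j : i != j -> S_rel (serre_sum f i j) 0.

Definition Salg : ratAlgType := presented_alg S_rel.

End SchurPresentation.

(* V is the simple module L_lam, up to isomorphism. *)
Definition simple_highest_weight (lam : weight n) (V : lmodType Ualg) : Prop :=
  simple_module V /\
  exists v : V,
    [/\ v != 0,
        forall i, U_e i *: v = 0,
        forall i, U_h i *: v = (in_rat (lam 0 i)%:~R : Ualg) *: v &
        forall w, exists u : Ualg, w = u *: v].

Section DonkinSchurAlgebra.
Variable pi : set (weight n).

Definition belongs_to (V : lmodType Ualg) : Prop :=
  finite_dimensional V /\
  forall (c : composition_series V) (i : nat), (i < cs_length c)%N ->
    exists2 lam, pi lam &
      simple_highest_weight lam (factor_mod (cs_term c i.+1) (cs_term c i)).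

Definition donkin_ideal : {pred Ualg} :=
  fun u => `[< forall V : lmodType Ualg, belongs_to V ->
                 forall v : V, u *: v = 0 >].

Lemma donkin_ideal_zmod : zmod_closed donkin_ideal.
Proof.
split; first by apply/asboolP => V _ v; rewrite scale0r.
move=> x y /asboolP hx /asboolP hy; apply/asboolP => V hV v.
by rewrite scalerBl hx // hy // subr0.
Qed.

Lemma donkin_idealMl (x y : Ualg) : donkin_ideal y -> donkin_ideal (x * y).
Proof.
move=> /asboolP hy; apply/asboolP => V hV v.
by rewrite -scalerA hy // scaler0.
Qed.

Lemma donkin_idealMr (x y : Ualg) : donkin_ideal x -> donkin_ideal (x * y).
Proof.
move=> /asboolP hx; apply/asboolP => V hV v.
by rewrite -scalerA hx.
Qed.

HB.instance Definition _ :=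
  GRing.isZmodClosed.Build Ualg donkin_ideal donkin_ideal_zmod.
HB.instance Definition _ :=
  isTwoSided.Build Ualg donkin_ideal donkin_idealMl donkin_idealMr.

(* The generalized Schur algebra attached to pi in the sense of Donkin. *)
Definition generalized_schur_alg : ratAlgType := alg_quot donkin_ideal.

End DonkinSchurAlgebra.

End RootData.

(* Main.v *)
Require Import Defs.
From HB Require Import structures.
From mathcomp Require Import all_boot all_order all_algebra generic_quotient.
From mathcomp Require Import finmap.
From mathcomp.classical Require Import boolp classical_sets cardinality fsbigop.
From mathcomp.multinomials Require Import monalg.
From mathcomp Require Import zify ring lra.

Set Implicit Arguments.
Unset Strict Implicit.
Unset Printing Implicit Defensive.

Import Order.TTheory GRing.Theory Num.Theory.
Local Open Scope classical_set_scope.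
Local Open Scope ring_scope.
Local Open Scope quotient_scope.

(** Sending [e_i] to [e_i], [f_i] to [f_i] and [h_i] to the sum of the
    [<alpha_i^vee, lam> 1_lam] defines a homomorphism [phi] from [U] to [S(pi)].
    The theorem says that [phi] is onto with kernel the annihilator ideal [I] of
    the modules belonging to [pi].  Instead of computing the kernel, one builds
    the inverse map: [psi] from [S(pi)] to [U/I] sends [1_lam] to the class of
    a polynomial [p_lam] in the [h_i] taking the value 1 at [lam] and 0 at the
    other weights in [W pi].  Then [psi] composed with [phi] is the projection
    of [U] onto [U/I], and everything reduces to two facts.

    First, [psi] respects the relations of [S(pi)] ([projection_relations]).
    On a finite-dimensional [U]-module the [h_i] are simultaneously
    diagonalizable with integral eigenvalues ([weight_ind]): [e_i] and [f_i]
    are nilpotent, and it follows from the commutation relations of the triple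
    [e_i, f_i, h_i] that [h_i] satisfies a squarefree polynomial with integral roots
    ([raising_nilpotent], [sl2_integral], [sl2_squarefree]).  The set of weights
    is stable under [W] ([weight_reflect]), and each weight is a weight of a
    composition factor; if the module belongs to [pi], a dominant weight thus
    lies below some element of [pi], hence in [pi], and all weights lie in
    [W pi] ([belongs_weight]).  So [p_lam] acts as the projection onto the weight
    space of [lam], and the relations hold modulo [I].

    Second, [I] is contained in the kernel of [phi], because [S(pi)] as a
    [U]-module belongs to [pi] ([schur_belongs_to]).  It is spanned by products
    of an [f]-word, an idempotent and an [e]-word, and long words vanish since
    the heights of the finitely many weights of [W pi] are bounded
    ([schur_finite_dimensional]).  A composition factor contains a weight vector
    of maximal height; its weight is dominant, and belongs to [W pi].  It
    remains that dominant weights of [W pi] are in [pi], which holds since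
    [w mu <= mu] for dominant [mu] ([word_act_le]).  The last inequality uses
    that roots are positive or negative ([root_sign]), proved from the length
    of roots and their integrality. *)

(** * Free algebras, presentations and quotients by ideals *)

Section FreeAlgebraEval.
Variables (G : choiceType) (B : ratAlgType) (t : G -> B).

Definition free_eval (x : free_alg G) : B :=
  \sum_(m <- msupp x) in_rat x@_m * \prod_(g <- (m : seq G)) t g.

Lemma free_evalEw (d : {fset {fmonom G}}) (x : free_alg G) :
  fsubset (msupp x) d ->
  free_eval x = \sum_(m <- d) in_rat x@_m * \prod_(g <- (m : seq G)) t g.
Proof.
move=> le; rewrite [LHS](big_fset_incl _ le) => //= m md /mcoeff_outdom ->.
by rewrite raddf0 mul0r.
Qed.

Lemma free_eval_zmod : zmod_morphism free_eval.
Proof.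
move=> x y.
pose E : {fset {fmonom G}} := (msupp x `|` msupp y `|` msupp (x - y))%fset.
have Ex : fsubset (msupp x) E by rewrite /E -fsetUA fsubsetUl.
have Ey : fsubset (msupp y) E by rewrite /E -fsetUA fsetUCA fsubsetUl.
rewrite (free_evalEw Ex) (free_evalEw Ey) (@free_evalEw E) ?fsubsetUr //.
by rewrite -sumrB; apply: eq_bigr => m _; rewrite mcoeffB raddfB mulrBl.
Qed.

HB.instance Definition _ :=
  GRing.isZmodMorphism.Build (free_alg G) B free_eval free_eval_zmod.

Lemma free_evalU (c : rat) (m : {fmonom G}) :
  free_eval << c *g m >> = in_rat c * \prod_(g <- (m : seq G)) t g.
Proof. by rewrite (free_evalEw msuppU_le) big_seq_fset1 mcoeffUU. Qed.

Lemma free_eval_in_rat (c : rat) : free_eval (in_rat c) = in_rat c.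
Proof. by rewrite [LHS]free_evalU fm1 big_nil mulr1. Qed.

Lemma free_eval_monoid : monoid_morphism free_eval.
Proof.
split=> [|x y]; first by have := free_eval_in_rat 1; rewrite !rmorph1.
rewrite [in LHS](monalgE x) [in LHS](monalgE y) mulr_suml raddf_sum /=.
rewrite [in RHS](monalgE x) raddf_sum /= mulr_suml; apply: eq_bigr => k _.
rewrite mulr_sumr [in RHS](monalgE y) !raddf_sum /= mulr_sumr.
apply: eq_bigr => l _.
have -> : (<< x@_k *g k >> : free_alg G) * << y@_l *g l >> =
          << x@_k * y@_l *g mmul k l >> by exact: fgmulUU.
rewrite !free_evalU fmM big_cat rmorphM /=.
by rewrite -!mulrA; congr (_ * _); rewrite !mulrA in_ratC.
Qed.

HB.instance Definition _ :=
  GRing.isMonoidMorphism.Build (free_alg G) B free_eval free_eval_monoid.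

Lemma free_eval_gen (g : G) : free_eval (free_gen g) = t g.
Proof. by rewrite [LHS]free_evalU rmorph1 mul1r fmU big_seq1. Qed.

End FreeAlgebraEval.

Lemma free_evalM (G : choiceType) (B : ratAlgType) (t : G -> B) (x y : free_alg G) :
  free_eval t (x * y) = free_eval t x * free_eval t y.
Proof. exact: rmorphM. Qed.

Lemma free_eval_mulB (G : choiceType) (B : ratAlgType) (t : G -> B)
    (a b c d : free_alg G) :
  free_eval t (a * b - c * d) =
  free_eval t a * free_eval t b - free_eval t c * free_eval t d.
Proof. by rewrite [LHS]rmorphB; congr (_ - _); exact: free_evalM. Qed.

Lemma free_alg_ind (G : choiceType) (P : free_alg G -> Prop) :
  (forall x y, P x -> P y -> P (x + y)) ->
  (forall q x, P x -> P (in_rat q * x)) -> P 1 ->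
  (forall g x, P x -> P (free_gen g * x)) -> forall x, P x.
Proof.
move=> PD PZ P1 Pg x; have P0 : P 0 by have := PZ 0 _ P1; rewrite raddf0 mul0r.
rewrite (monalgE x); apply: big_ind => // m _.
have -> : (<< x@_m *g m >> : free_alg G) = in_rat x@_m * (<< (1 : rat) *g m >> : free_alg G).
  have := @fgmulUU _ rat (x@_m) 1 mone m.
  by rewrite mulr1 mul1m => <-.
apply: PZ; case: m => s; elim: s => [|g s IHs].
  suff -> : (<< (1 : rat) *g FMonom [::] >> : free_alg G) = 1 by [].
  by rewrite -fmoneE.
have -> : (<< (1 : rat) *g FMonom (g :: s) >> : free_alg G) =
    free_gen g * (<< (1 : rat) *g FMonom s >> : free_alg G).
  have := @fgmulUU _ rat 1 1 (fmu g) (FMonom s).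
  rewrite mulr1; suff -> : mmul (fmu g) (FMonom s) = FMonom (g :: s) by move=> <-.
  by apply/eqP; rewrite fmP fmM fmU.
exact: Pg.
Qed.

Section Kernel.
Variables (A B : pzRingType) (phi : {rmorphism A -> B}).

Definition ring_kernel : {pred A} := fun x => phi x == 0.

Lemma ring_kernel_zmod : zmod_closed ring_kernel.
Proof.
split=> [|x y]; first by apply/eqP; rewrite rmorph0.
by move=> /eqP hx /eqP hy; apply/eqP; rewrite rmorphB hx hy subr0.
Qed.

Lemma ring_kernelMl (x y : A) : ring_kernel y -> ring_kernel (x * y).
Proof. by move=> /eqP hy; rewrite /ring_kernel rmorphM hy mulr0. Qed.

Lemma ring_kernelMr (x y : A) : ring_kernel x -> ring_kernel (x * y).
Proof. by move=> /eqP hx; rewrite /ring_kernel rmorphM hx mul0r. Qed.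

HB.instance Definition _ := GRing.isZmodClosed.Build A ring_kernel ring_kernel_zmod.
HB.instance Definition _ :=
  isTwoSided.Build A ring_kernel ring_kernelMl ring_kernelMr.

Lemma ideal_gen_ker (R : set A) (x : A) :
  (forall r, R r -> phi r = 0) -> x \in ideal_gen R -> phi x = 0.
Proof.
move=> hR /asboolP /(_ ring_kernel) hx; apply/eqP.
by apply: hx => r /hR /eqP.
Qed.

End Kernel.

Lemma alg_piW (A : ratAlgType) (I : idealType A) (P : alg_quot I -> Prop) :
  (forall x, P (alg_pi I x)) -> forall x, P x.
Proof. exact: alg_quotW. Qed.

Section QuotientProduct.
Variables (A : ratAlgType) (I : idealType A).

Lemma alg_piM (x y : A) : alg_pi I (x * y) = alg_pi I x * alg_pi I y.
Proof. exact: rmorphM. Qed.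

Lemma alg_piN (x : A) : alg_pi I (- x) = - alg_pi I x.
Proof. exact: rmorphN. Qed.

Lemma alg_pi_mulB (a b c d : A) :
  alg_pi I (a * b - c * d) = alg_pi I a * alg_pi I b - alg_pi I c * alg_pi I d.
Proof. by rewrite [LHS]rmorphB; congr (_ - _); exact: alg_piM. Qed.

End QuotientProduct.

Section QuotientLift.
Variables (A B : ratAlgType) (I : idealType A) (phi : {rmorphism A -> B}).
Hypothesis phiI : forall x, x \in I -> phi x = 0.

(** The proof that [phi] kills the ideal is part of the term, so that the
    structure of homomorphism is inferred from it. *)
Definition quot_lift (_ : forall x, x \in I -> phi x = 0) (x : alg_quot I) : B :=
  phi (repr x).

Lemma quot_lift_pi x : quot_lift phiI (alg_pi I x) = phi x.
Proof.
apply/eqP; rewrite /quot_lift -subr_eq0 -rmorphB phiI //.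
by apply/alg_quotP; rewrite reprK.
Qed.

Lemma quot_lift_zmod : zmod_morphism (quot_lift phiI).
Proof.
move=> x y; elim/alg_piW: x => x; elim/alg_piW: y => y.
by rewrite -raddfB !quot_lift_pi raddfB.
Qed.

Lemma quot_lift_monoid : monoid_morphism (quot_lift phiI).
Proof.
split; first by rewrite -(rmorph1 (alg_pi I)) quot_lift_pi rmorph1.
move=> x y; elim/alg_piW: x => x; elim/alg_piW: y => y.
by rewrite -rmorphM !quot_lift_pi rmorphM.
Qed.

HB.instance Definition _ := GRing.isZmodMorphism.Build (alg_quot I) B
  (quot_lift phiI) quot_lift_zmod.
HB.instance Definition _ := GRing.isMonoidMorphism.Build (alg_quot I) B
  (quot_lift phiI) quot_lift_monoid.

End QuotientLift.

Section PresentationTheory.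
Variables (G : choiceType) (R : free_alg G -> free_alg G -> Prop).

Lemma pgen_rel (x y : free_alg G) : R x y ->
  alg_pi (relation_ideal R) x = alg_pi (relation_ideal R) y.
Proof.
move=> Rxy; apply/alg_piP; apply/asboolP => I; apply.
by exists x, y.
Qed.

Lemma presented_ind (P : presented_alg R -> Prop) :
  (forall x y, P x -> P y -> P (x + y)) ->
  (forall q x, P x -> P (in_rat q * x)) -> P 1 ->
  (forall g x, P x -> P (pgen R g * x)) -> forall x, P x.
Proof.
move=> PD PZ P1 Pg x; elim/alg_piW: x => x.
elim/free_alg_ind: x => [x y Px Py|q x Px||g x Px].
- by rewrite raddfD; exact: PD.
- by rewrite rmorphM; exact: PZ.
- by rewrite rmorph1.
- by rewrite rmorphM; exact: Pg.
Qed.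

Variables (B : ratAlgType) (t : G -> B).
Hypothesis tR : forall x y, R x y -> free_eval t x = free_eval t y.

Lemma free_eval_relation x : x \in relation_ideal R -> free_eval t x = 0.
Proof.
apply: ideal_gen_ker => _ [a [b [Rab ->]]].
by rewrite raddfB /= (tR Rab) subrr.
Qed.

Definition presented_lift : presented_alg R -> B := quot_lift free_eval_relation.

HB.instance Definition _ := GRing.RMorphism.on presented_lift.

Lemma presented_lift_gen g : presented_lift (pgen R g) = t g.
Proof. by rewrite [LHS]quot_lift_pi [LHS]free_eval_gen. Qed.

Lemma presented_lift_in_rat q : presented_lift (in_rat q) = in_rat q.
Proof. by rewrite [LHS]quot_lift_pi [LHS]free_eval_in_rat. Qed.

End PresentationTheory.

Lemma presented_hom_eq (G : choiceType) (R : free_alg G -> free_alg G -> Prop)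
    (B : ratAlgType) (phi psi : {rmorphism presented_alg R -> B}) :
  (forall q, phi (in_rat q) = psi (in_rat q)) ->
  (forall g, phi (pgen R g) = psi (pgen R g)) -> phi =1 psi.
Proof.
move=> hq hg; elim/presented_ind => [x y hx hy|q x hx||g x hx].
- by rewrite !rmorphD hx hy.
- by rewrite !rmorphM hx hq.
- by rewrite !rmorph1.
- by rewrite !rmorphM hx hg.
Qed.

Lemma rmorph_serre_sum n (A : 'M[int]_n) (R S : pzRingType) (phi : {rmorphism R -> S})
    (x : 'I_n -> R) i j :
  phi (serre_sum A x i j) = serre_sum A (phi \o x) i j.
Proof.
rewrite raddf_sum; apply: eq_bigr => s _ /=.
by rewrite !rmorphM !rmorphXn rmorphN rmorph1 rmorph_nat.
Qed.

(** * The Weyl group acting on words: signs of roots and deletion *)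

Section WeylCombinatorics.
Variables (n : nat) (A : 'M[int]_n).

Local Notation alpha := (simple_root A).
Local Notation s_ := (simple_reflection A).

(** Row vectors also serve as coordinates of elements of the root lattice on the
    simple roots: the coordinates [x] stand for the weight [x *m A^T], and this
    is the simple reflection in these coordinates. *)
Definition coord_refl (j : 'I_n) (x : 'rV[int]_n) : 'rV[int]_n :=
  x - (x *m A^T) 0 j *: delta_mx 0 j.

Definition word_act (w : seq 'I_n) (lam : weight n) : weight n := foldr s_ lam w.
Definition coord_act (w : seq 'I_n) (x : 'rV[int]_n) : 'rV[int]_n :=
  foldr coord_refl x w.

Definition coord_nonneg (x : 'rV[int]_n) : Prop := forall k, 0 <= x 0 k.

Lemma delta_mulA (j : 'I_n) : delta_mx 0 j *m A^T = alpha j.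
Proof. by rewrite -rowE; apply/rowP => i; rewrite !mxE. Qed.

Lemma coord_refl_weight j x : coord_refl j x *m A^T = s_ j (x *m A^T).
Proof. by rewrite /coord_refl mulmxBl -scalemxAl delta_mulA. Qed.

Lemma coord_act_weight w x : coord_act w x *m A^T = word_act w (x *m A^T).
Proof. by elim: w => //= j w IHw; rewrite coord_refl_weight IHw. Qed.

Lemma simple_reflectionB j lam mu c :
  s_ j (lam - c *: mu) = s_ j lam - c *: s_ j mu.
Proof.
rewrite /simple_reflection !mxE scalerBr scalerBl scalerA.
by apply/rowP => k; rewrite !mxE; ring.
Qed.

Lemma word_actB w lam mu c :
  word_act w (lam - c *: mu) = word_act w lam - c *: word_act w mu.
Proof. by elim: w => //= j w ->; rewrite simple_reflectionB. Qed.

Lemma word_act_rcons w i lam : word_act (rcons w i) lam = word_act w (s_ i lam).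
Proof. by rewrite /word_act foldr_rcons. Qed.

Lemma weylP u : weyl A u <-> exists w, u = word_act w.
Proof.
split=> [|[w ->]]; first elim=> [|i v _ [w ->]]; [by exists [::]|by exists (i :: w)|].
elim: w => [|i w IHw]; first exact: weyl_id.
exact: (weyl_comp i IHw).
Qed.

Lemma weight_le_coord lam mu x :
  coord_nonneg x -> mu - lam = x *m A^T -> weight_le A lam mu.
Proof.
move=> x0 E; exists (fun k => `|x 0%R k|%N); rewrite E mulmx_sum_row.
apply: eq_bigr => k _; rewrite -delta_mulA -rowE -scaler_nat; congr (_ *: _).
by rewrite natz gez0_abs.
Qed.

Lemma weight_le_trans lam mu nu :
  weight_le A lam mu -> weight_le A mu nu -> weight_le A lam nu.
Proof.
move=> [k Ek] [l El]; exists (fun i => k i + l i)%N.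
rewrite -(subrK mu nu) -addrA El Ek -big_split /=.
by apply: eq_bigr => i _; rewrite mulrnDr addrC.
Qed.

Lemma weight_le_refl lam : weight_le A lam lam.
Proof. by exists (fun=> 0%N); rewrite subrr big1. Qed.

Hypothesis A2 : forall i, A i i = 2.
Hypothesis Aneg : forall i j, i != j -> A i j <= 0.

Lemma simple_reflection_alpha i : s_ i (alpha i) = - alpha i.
Proof. by rewrite /simple_reflection mxE A2; apply/rowP => k; rewrite !mxE; ring. Qed.

Lemma simple_reflectionK i : involutive (s_ i).
Proof.
move=> lam; rewrite {2}/simple_reflection simple_reflectionB simple_reflection_alpha.
by rewrite /simple_reflection; apply/rowP => k; rewrite !mxE; ring.
Qed.

Variable d : 'I_n -> int.
Hypothesis d_gt0 : forall i, 0 < d i.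
Hypothesis dA : forall i j, d i * A i j = d j * A j i.

(** The invariant form, between coordinates on the simple roots and weights:
    the symmetrizing integers [d] are half the squared lengths. *)
Definition root_pair (x : 'rV[int]_n) (lam : weight n) : int :=
  \sum_k x 0 k * d k * lam 0 k.

Lemma root_pairB x c y lam mu e :
  root_pair (x - c *: y) (lam - e *: mu) =
  root_pair x lam - e * root_pair x mu - c * root_pair y lam + c * e * root_pair y mu.
Proof.
rewrite /root_pair !mulr_sumr -!sumrB -big_split /=.
by apply: eq_bigr => k _; rewrite !mxE; ring.
Qed.

Lemma root_pair_delta j lam : root_pair (delta_mx 0 j) lam = d j * lam 0 j.
Proof.
rewrite /root_pair (bigD1 j) //= big1 ?addr0 => [|k kj]; rewrite !mxE ?eqxx ?mul1r //.
by rewrite (negbTE kj) !mul0r.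
Qed.

Lemma root_pair_alpha x j : root_pair x (alpha j) = d j * (x *m A^T) 0 j.
Proof.
rewrite mxE mulr_sumr; apply: eq_bigr => k _; rewrite !mxE.
by rewrite -mulrA dA; ring.
Qed.

Lemma root_pair_refl j x lam : root_pair (coord_refl j x) (s_ j lam) = root_pair x lam.
Proof.
rewrite root_pairB root_pair_alpha !root_pair_delta.
by set a := (x *m A^T) 0 j; rewrite mxE A2; ring.
Qed.

Lemma root_pair_act w x lam :
  root_pair (coord_act w x) (word_act w lam) = root_pair x lam.
Proof. by elim: w => //= j w <-; rewrite root_pair_refl. Qed.

Definition root_norm x := root_pair x (x *m A^T).

Hypothesis root_norm_gt0 : forall x, x != 0 -> 0 < root_norm x.

Lemma root_norm_act w x : root_norm (coord_act w x) = root_norm x.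
Proof. by rewrite /root_norm coord_act_weight root_pair_act. Qed.

Lemma root_norm_delta j : root_norm (delta_mx 0 j) = 2 * d j.
Proof. by rewrite /root_norm root_pair_delta delta_mulA mxE A2 mulrC. Qed.

(** When [x] is a root in the orbit of [alpha_i], the coroot of [x] is
    [x / d_i], and [coord_dvd i x] says that it is in the lattice spanned by the
    simple coroots [alpha_k / d_k]. *)
Definition coord_dvd (i : 'I_n) (x : 'rV[int]_n) : Prop :=
  exists t : 'I_n -> int, forall k, x 0 k * d k = d i * t k.

Lemma coord_dvd_refl i j x : coord_dvd i x -> coord_dvd i (coord_refl j x).
Proof.
move=> [t tE].
exists (fun k => t k - (if k == j then \sum_l t l * A l j else 0)) => k.
rewrite !mxE eqxx /=; have [->|_] := eqVneq k j; last by rewrite mulr0 !subr0.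
rewrite mulr1 mulrBl mulrBr tE; congr (_ - _).
rewrite mulr_suml mulr_sumr; apply: eq_bigr => l _.
by rewrite mulrA -tE -!mulrA mxE; congr (_ * _); rewrite dA mulrC.
Qed.

Lemma coord_dvd_act i w : coord_dvd i (coord_act w (delta_mx 0 i)).
Proof.
elim: w => /= [|j w IHw]; last exact: coord_dvd_refl.
exists (fun k => (k == i)%:R) => k; rewrite mxE eqxx /=.
by have [->|_] := eqVneq k i; rewrite ?mul1r ?mulr1 ?mul0r ?mulr0.
Qed.

Lemma sum_sym_even (F : 'I_n -> 'I_n -> int) :
  (forall k l, F k l = F l k) ->
  exists u, \sum_k \sum_l F k l = \sum_k F k k + 2 * u.
Proof.
move=> Fs; exists (\sum_(k < n) \sum_(l < n | (l < k)%N) F k l).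
have -> : \sum_k \sum_l F k l = \sum_(k < n) (F k k + (\sum_(l < n | (l < k)%N) F k l
   + \sum_(l < n | (k < l)%N) F k l)).
  apply: eq_bigr => k _; rewrite (bigD1 k) //=; congr (_ + _).
  rewrite (bigID (fun l : 'I_n => (l < k)%N)) /=; congr (_ + _); apply: eq_bigl => l.
    by rewrite -val_eqE /=; lia.
  by rewrite -val_eqE /=; lia.
rewrite !big_split /=; congr (_ + _).
have -> : \sum_(i < n) \sum_(l < n | (i < l)%N) F i l =
          \sum_(i < n) \sum_(l < n | (l < i)%N) F i l.
  rewrite (exchange_big_dep predT) //=; apply: eq_bigr => k _.
  by apply: eq_bigr => l _; rewrite Fs.
by ring.
Qed.

(** On the multiples by [d_i] of the coroot lattice the form takes values in
    [2 d_i Z], since diagonal terms are even and the others come in pairs. *)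
Lemma root_norm_even i x : coord_dvd i x -> exists u, root_norm x = 2 * d i * u.
Proof.
move=> [t tE].
have E k l : x 0 k * d k * (A k l * x 0 l) = d i * (t k * A k l * x 0 l).
  by rewrite tE; ring.
have di0 : d i != 0 by rewrite gt_eqF.
have [k l|u uE] := @sum_sym_even (fun k l => t k * A k l * x 0 l).
  apply: (mulfI di0); rewrite -!E; rewrite -!mulrA ![in d _ * _]mulrA.
  by rewrite dA; ring.
exists (\sum_k t k * x 0 k + u).
transitivity (d i * \sum_k \sum_l t k * A k l * x 0 l).
  rewrite /root_norm /root_pair mulr_sumr; apply: eq_bigr => k _.
  rewrite mxE !mulr_sumr; apply: eq_bigr => l _; rewrite -E mxE; ring.
rewrite uE; have -> : \sum_k t k * A k k * x 0 k = 2 * \sum_k t k * x 0 k.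
  by rewrite mulr_sumr; apply: eq_bigr => k _; rewrite A2; ring.
by ring.
Qed.

Definition pos_part (x : 'rV[int]_n) : 'rV[int]_n := \row_k Num.max (x 0 k) 0.

Lemma coord_dvd_pos i x : coord_dvd i x -> coord_dvd i (pos_part x).
Proof.
move=> [t tE]; exists (fun k => if 0 <= x 0 k then t k else 0) => k; rewrite mxE.
by case: leP => h; rewrite ?tE // mul0r mulr0.
Qed.

Lemma coord_dvdN i x : coord_dvd i x -> coord_dvd i (- x).
Proof. by move=> [t tE]; exists (fun k => - t k) => k; rewrite mxE mulNr tE mulrN. Qed.

(** Write [x = p - m] with [p] and [m] nonnegative of disjoint supports.  Then
    [(p, m) <= 0], so the squared length of [x] is at least that of [p] plus
    that of [m]; if both are nonzero, each of these is a positive multiple of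
    [2 d_i] and the sum exceeds [2 d_i]. *)
Lemma root_sign i x : root_norm x = 2 * d i -> coord_dvd i x ->
  coord_nonneg x \/ coord_nonneg (- x).
Proof.
move=> xn xd; apply: contrapT => /not_orP[x1 x2].
set p := pos_part x; set m := pos_part (- x).
have mx (a : int) : [/\ 0 <= Num.max a 0, a = Num.max a 0 - Num.max (- a) 0 &
    Num.max a 0 * Num.max (- a) 0 = 0].
  by rewrite !maxEle; split; do ?case: ifP; rewrite ?mulr0 ?mul0r //; lia.
have xE : x = p - 1 *: m.
  by apply/rowP => k; rewrite !mxE mul1r; have [_] := mx (x 0 k).
have big y : coord_dvd i y -> y != 0 -> 2 * d i <= root_norm y.
  move=> /root_norm_even[u uE] /root_norm_gt0; rewrite uE.
  have di : 0 < 2 * d i by rewrite mulr_gt0.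
  by rewrite pmulr_rgt0 // => u0; rewrite ler_pMr //; lia.
have p0 : p != 0.
  apply: contra_notN x2 => /eqP/rowP p0 k; have := p0 k; rewrite !mxE => h.
  by have [_ -> _] := mx (x 0 k); rewrite h; have [] := mx (- x 0 k); lia.
have m0 : m != 0.
  apply: contra_notN x1 => /eqP/rowP m0 k; have := m0 k; rewrite !mxE => h.
  by have [] := mx (x 0 k); rewrite h; lia.
have hp : 2 * d i <= root_norm p := big _ (coord_dvd_pos xd) p0.
have hm : 2 * d i <= root_norm m := big _ (coord_dvd_pos (coord_dvdN xd)) m0.
have cross (y z : 'rV[int]_n) : (forall k, 0 <= y 0 k) -> (forall k, 0 <= z 0 k) ->
  (forall k, y 0 k * z 0 k = 0) -> root_pair y (z *m A^T) <= 0.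
  move=> y0 z0 yz; apply: sumr_le0 => k _; rewrite mxE mulr_sumr.
  apply: sumr_le0 => l _; rewrite mxE.
  have [<-|kl] := eqVneq k l.
    have -> : y 0 k * d k * (z 0 k * A k k) = y 0 k * z 0 k * d k * A k k by ring.
    by rewrite yz !mul0r.
  have := Aneg kl; have := y0 k; have := z0 l; have := d_gt0 k.
  move=> h1 h2 h3 h4; rewrite mulrA; apply: mulr_ge0_le0 => //.
  by rewrite !mulr_ge0 // ltW.
have c1 : root_pair p (m *m A^T) <= 0.
  apply: cross => k; rewrite !mxE; first by case: (mx (x 0 k)).
    by case: (mx (- x 0 k)).
  by case: (mx (x 0 k)).
have c2 : root_pair m (p *m A^T) <= 0.
  apply: cross => k; rewrite !mxE; first by case: (mx (- x 0 k)).
    by case: (mx (x 0 k)).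
  by rewrite mulrC; case: (mx (x 0 k)).
have : root_norm x = root_norm p + root_norm m
    - root_pair p (m *m A^T) - root_pair m (p *m A^T).
  by rewrite {1}/root_norm {1 2}xE mulmxBl -scalemxAl root_pairB /root_norm; ring.
have := d_gt0 i; rewrite xn; lia.
Qed.

Lemma word_root_sign w i : let x := coord_act w (delta_mx 0 i) in
  coord_nonneg x \/ coord_nonneg (- x).
Proof.
apply: (@root_sign i); last exact: coord_dvd_act.
by rewrite root_norm_act root_norm_delta.
Qed.

(** The exchange condition: following the simple root [alpha_i] along the word
    from the right, it becomes negative at some letter [j].  Just before, all
    its coordinates other than the [j]-th vanish, so it is [alpha_j] and the
    letter [j] cancels the reflection [s_i]. *)
Lemma word_deletion w i : ~ coord_nonneg (coord_act w (delta_mx 0 i)) ->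
  exists2 w', size w = (size w').+1 &
    forall lam, word_act w (s_ i lam) = word_act w' lam.
Proof.
elim: w => [|j w IHw] /=.
  by case=> k; rewrite mxE; case: (_ && _).
set c := coord_act w _ => neg.
have [c0|/IHw[w' sw' w'E]] := pselect (coord_nonneg c); last first.
  by exists (j :: w') => [|lam] /=; rewrite ?sw' ?w'E.
exists w => // lam.
have cneg : coord_nonneg (- coord_refl j c).
  by have [] := word_root_sign (j :: w) i.
(* s_j changes the j-th coordinate only *)
have ck k : k != j -> c 0 k = 0.
  move=> kj; have := cneg k; have := c0 k; rewrite !mxE eqxx /= (negbTE kj) mulr0; lia.
have cE : c = c 0 j *: delta_mx 0 j.
  apply/rowP => k; rewrite !mxE eqxx /=; have [->|/ck->] := eqVneq k j.
    by rewrite mulr1.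
  by rewrite mulr0.
have cn : root_norm c = 2 * d i by rewrite root_norm_act root_norm_delta.
have cn' : root_norm c = c 0 j * c 0 j * (2 * d j).
  rewrite [in LHS]cE /root_norm -scalemxAl delta_mulA.
  rewrite (_ : c 0 j *: delta_mx 0 j = 0 - (- c 0 j) *: delta_mx 0 j); last first.
    by rewrite sub0r scaleNr opprK.
  rewrite (_ : c 0 j *: alpha j = 0 - (- c 0 j) *: alpha j); last first.
    by rewrite sub0r scaleNr opprK.
  have rp0 lam' : root_pair 0 lam' = 0.
    by rewrite /root_pair big1 // => k _; rewrite mxE !mul0r.
  by rewrite root_pairB !rp0 !root_pair_delta !mxE A2; ring.
have [t tE] := coord_dvd_act i w.
have di0 : d i != 0 by rewrite gt_eqF.
(* c = c_j alpha_j has the length of alpha_i and an integral coroot *)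
have cj1 : c 0 j = 1.
  have := tE j; rewrite -/c => tj.
  have h1 : d i * (c 0 j * t j) = d i * 1.
    by rewrite mulr1 mulrCA -tj; have := cn; rewrite cn'; lia.
  move/(mulfI di0): h1.
  move: (c 0 j) (t j) (c0 j) => a b a0 ab.
  have [b0|b0] : b <= 0 \/ 1 <= b by lia.
    by have := mulr_ge0_le0 a0 b0; rewrite ab.
  have [a00|a1] : a = 0 \/ 1 <= a by lia.
    by move: ab; rewrite a00 mul0r.
  have := mulr_ge0 (_ : 0 <= a - 1) (_ : 0 <= b - 1); nia.
have dij : d j = d i by have := cn; rewrite cn' cj1; lia.
have wa : word_act w (alpha i) = alpha j.
  by rewrite -[in LHS]delta_mulA -coord_act_weight -/c cE cj1 scale1r delta_mulA.
rewrite {2}/simple_reflection word_actB wa.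
have : (word_act w lam) 0 j = lam 0 i.
  have := root_pair_act w (delta_mx 0 i) lam; rewrite -/c cE cj1 scale1r.
  rewrite !root_pair_delta dij => h.
  exact: (mulfI di0) h.
move=> h; rewrite simple_reflectionB simple_reflection_alpha /simple_reflection h.
by rewrite scalerN opprK subrK.
Qed.

(** Induction on the length: if the last reflection makes the root negative, the
    word can be shortened, and otherwise it subtracts a nonnegative multiple of
    a positive root. *)
Lemma word_act_le w mu : dominant mu -> weight_le A (word_act w mu) mu.
Proof.
move=> mu0; have [m] := ubnP (size w); elim: m w => // m IHm w.
case/lastP: w => [_|w i]; first exact: weight_le_refl.
rewrite size_rcons => sw; rewrite word_act_rcons.
have [c0|/word_deletion[w' sw' ->]] :=
    pselect (coord_nonneg (coord_act w (delta_mx 0 i))); last first.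
  by apply: IHm; move: sw; rewrite sw'; lia.
apply: (@weight_le_trans _ (word_act w mu)); last by apply: IHm; lia.
apply: (@weight_le_coord _ _ (mu 0 i *: coord_act w (delta_mx 0 i))).
  by move=> k; rewrite mxE mulr_ge0.
rewrite word_actB opprB addrC subrK -scalemxAl coord_act_weight delta_mulA.
by [].
Qed.

End WeylCombinatorics.

(** * Heights, finiteness of orbits and dominant weights *)

Lemma finite_set_max (T : choiceType) (f : T -> rat) (P : set T) :
  finite_set P -> P !=set0 -> exists2 x, P x & forall y, P y -> f y <= f x.
Proof.
move=> /finite_seqP[s ->]; elim: s => [[x]//|x s IHs] _.
have [[y ys]|s0] := pselect ([set` s] !=set0).
  have [|z zs zmax] := IHs; first by exists y.
  have [xz|zx] := leP (f x) (f z).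
    exists z => [|t /=]; first by rewrite /= inE [z \in s]zs orbT.
    by rewrite inE => /orP[/eqP ->|/zmax].
  exists x => [|t /=]; first by rewrite /= mem_head.
  by rewrite inE => /orP[/eqP -> //|/zmax /le_trans]; apply; exact: ltW.
exists x => [|t /=]; first by rewrite /= mem_head.
by rewrite inE => /orP[/eqP -> //|ts]; case: s0; exists t.
Qed.

Section FiniteType.
Variables (n : nat) (A : 'M[int]_n).
Hypothesis hA : cartan_finite_type A.

Local Notation alpha := (simple_root A).
Local Notation s_ := (simple_reflection A).

Local Notation AQ := (map_mx (intr : int -> rat) A^T).

Lemma cartan_kernel (x : 'rV[rat]_n) : x *m AQ = 0 -> x = 0.
Proof.
case: hA => _ _ [d [_ _ pos]] xA.
have h i : \sum_j (A i j)%:~R * x 0 j = 0 :> rat.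
  transitivity ((x *m AQ) 0 i); last by rewrite xA mxE.
  by rewrite mxE; apply: eq_bigr => j _; rewrite !mxE mulrC.
apply/rowP => i; rewrite mxE; apply/eqP; apply: contraT => xi.
have /pos : exists i, (fun i => x 0 i) i != 0 by exists i.
rewrite big1 ?ltxx // => k _.
rewrite (eq_bigr (fun j => (d k)%:~R * x 0 k * ((A k j)%:~R * x 0 j))).
  by rewrite -mulr_sumr h mulr0.
by move=> j _; rewrite intrM; ring.
Qed.

Lemma cartan_unit : AQ \in unitmx.
Proof. by rewrite -row_free_unit; apply: inj_row_free; exact: cartan_kernel. Qed.

(** Coordinates on the simple roots, rational since the root lattice has finite
    index in the weight lattice. *)
Definition root_coord (lam : weight n) : 'rV[rat]_n :=
  map_mx intr lam *m invmx AQ.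

Lemma root_coordE lam : root_coord lam *m AQ = map_mx intr lam.
Proof. by rewrite mulmxKV ?cartan_unit. Qed.

Lemma root_coord_alpha j : root_coord (alpha j) = delta_mx 0 j.
Proof.
rewrite /root_coord -delta_mulA map_mxM mulmxK ?cartan_unit //.
by apply/rowP => i; rewrite !mxE; case: (_ && _).
Qed.

Lemma root_coord_zmod : zmod_morphism root_coord.
Proof. by move=> x y; rewrite /root_coord map_mxB mulmxBl. Qed.

HB.instance Definition _ :=
  GRing.isZmodMorphism.Build (weight n) 'rV[rat]_n root_coord root_coord_zmod.

Lemma root_coordBalpha lam c j :
  root_coord (lam - c *: alpha j) = root_coord lam - c%:~R *: delta_mx 0 j.
Proof.
by rewrite raddfB /= -root_coord_alpha [root_coord (c *: _)]/root_coord map_mxZ -scalemxAl.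
Qed.

Definition height (lam : weight n) : rat := \sum_k root_coord lam 0 k.

Lemma height_zmod : zmod_morphism height.
Proof.
by move=> x y; rewrite /height raddfB -sumrB; apply: eq_bigr => k _; rewrite !mxE.
Qed.

HB.instance Definition _ :=
  GRing.isZmodMorphism.Build (weight n) rat height height_zmod.

Lemma height_alpha j : height (alpha j) = 1.
Proof.
rewrite /height root_coord_alpha (bigD1 j) //= big1 ?addr0 ?mxE ?eqxx // => k kj.
by rewrite mxE (negbTE kj).
Qed.

Lemma heightBalpha lam c j : height (lam - c *: alpha j) = height lam - c%:~R.
Proof.
transitivity (\sum_k (root_coord lam 0 k - c%:~R * root_coord (alpha j) 0 k)).
  by apply: eq_bigr => k _; rewrite root_coordBalpha root_coord_alpha !mxE.
by rewrite sumrB -mulr_sumr -/(height lam) -/(height (alpha j)) height_alpha mulr1.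
Qed.

(** The invariant form is constant on the orbit, and by Cauchy-Schwarz it bounds
    the coordinates [<alpha_j^vee, lam>] of a weight. *)
Lemma finite_word_orbit mu : finite_set [set lam | exists w, lam = word_act A w mu].
Proof.
case: hA => A2 _ [d [dval dA pos]].
have d1 i : 1 <= d i by have := dval i; rewrite !inE => /orP[/eqP->|/orP[]/eqP->].
pose Q (x : 'rV[rat]_n) : rat := \sum_i (d i)%:~R * x 0 i * (x *m AQ) 0 i.
have Q_ge0 x : 0 <= Q x.
  have [->|x0] := eqVneq x 0.
    by rewrite /Q big1 // => i _; rewrite mxE mulr0 mul0r.
  have /pos/ltW/le_trans : exists i, (fun i => x 0 i) i != 0.
    apply: contrapT => h; move/negP: x0; apply; apply/eqP/rowP => i; rewrite mxE.
    by apply/eqP; apply: contraT => xi; case: h; exists i.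
  apply; rewrite /Q le_eqVlt; apply/orP; left; apply/eqP/eq_bigr => i _.
  rewrite mxE mulr_sumr; apply: eq_bigr => j _; rewrite !mxE intrM; ring.
have Qsub x j t : Q (x - t *: delta_mx 0 j) =
    Q x - 2 * t * (d j)%:~R * (x *m AQ) 0 j + 2 * t ^+ 2 * (d j)%:~R.
  rewrite /Q mulmxBl -scalemxAl -rowE.
  have -> : 2 * t * (d j)%:~R * (x *m AQ) 0 j = t * (d j)%:~R * (x *m AQ) 0 j
      + t * \sum_i (d i)%:~R * x 0 i * (A i j)%:~R.
    have -> : \sum_i (d i)%:~R * x 0 i * (A i j)%:~R = (d j)%:~R * (x *m AQ) 0 j.
      rewrite mxE mulr_sumr; apply: eq_bigr => i _; rewrite !mxE.
      have := congr1 (intr : int -> rat) (dA i j); rewrite !intrM => h.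
      by rewrite mulrAC h; ring.
    by ring.
  have -> : 2 * t ^+ 2 * (d j)%:~R =
      \sum_i t ^+ 2 * (d i)%:~R * (i == j)%:R * (A i j)%:~R.
    rewrite (bigD1 j) //= big1 ?addr0 => [|k /negbTE ->]; last by rewrite mulr0 mul0r.
    by rewrite eqxx A2 /=; ring.
  have -> : t * (d j)%:~R * (x *m AQ) 0 j = \sum_i (d i)%:~R * t * (i == j)%:R * (x *m AQ) 0 i.
    rewrite (bigD1 j) //= big1 ?addr0 => [|k /negbTE ->]; last by rewrite mulr0 mul0r.
    by rewrite eqxx /=; ring.
  rewrite mulr_sumr opprD addrA -!sumrB -big_split /=.
  apply: eq_bigr => i _; rewrite !mxE eqxx /=; set S := \sum__ _.
  by ring.
pose q lam := Q (root_coord lam).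
have q_word w lam : q (word_act A w lam) = q lam.
  elim: w => //= j w <-; move: (word_act A w lam) => nu.
  by rewrite /q /simple_reflection root_coordBalpha Qsub root_coordE !mxE; ring.
have q_bound (lam : weight n) (j : 'I_n) : (lam 0 j)%:~R ^+ 2 <= 2 * q lam.
  (* half of the coordinate gives the minimum of the form on this line *)
  have := Q_ge0 (root_coord lam - ((lam 0 j)%:~R / 2) *: delta_mx 0 j).
  rewrite Qsub root_coordE mxE -/(q lam).
  have : (1 : rat) <= (d j)%:~R by rewrite -[1]/(1%:~R) ler_int.
  move: (d j)%:~R (lam 0 j)%:~R (q lam) => D x y hD h.
  have : D * x ^+ 2 <= 2 * y by move: h; lra.
  by apply: le_trans; rewrite ler_peMl // sqr_ge0.
have [N hN] : exists N : nat, 2 * q mu <= N%:R.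
  by exists (Num.bound (2 * q mu)); apply/ltW/archi_boundP; rewrite mulr_ge0 ?Q_ge0.
pose F (g : {ffun 'I_n -> 'I_(N + N).+1}) : weight n := \row_i ((g i : nat)%:Z - N%:Z).
apply: (@sub_finite_set _ _ [set F g | g in [set: {ffun 'I_n -> 'I_(N + N).+1}]]); last first.
  by apply: finite_image; exact: finite_finset.
move=> _ [w ->]; set lam : weight n := word_act _ _ _.
have hl (i : 'I_n) : - N%:Z <= lam 0 i <= N%:Z.
  have : lam 0 i ^+ 2 <= N%:Z.
    rewrite -(ler_int rat) rmorphXn /=; apply: le_trans (q_bound _ _) _.
    by rewrite q_word.
  move: (lam 0 i) => z hz; nia.
exists [ffun i => inord `|(lam 0 i + N%:Z)%R|%N] => //.
apply/rowP => i; rewrite mxE ffunE inordK; have := hl i; last lia.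
by move=> ?; rewrite gez0_abs; lia.
Qed.

Lemma word_actK w lam : word_act A (rev w) (word_act A w lam) = lam.
Proof.
case: hA => A2 _ _; elim: w => //= i w IHw.
by rewrite rev_cons word_act_rcons simple_reflectionK.
Qed.

(** A weight of maximal height in the orbit is dominant. *)
Lemma word_dominant lam : exists w, dominant (word_act A w lam).
Proof.
have [|_ [w ->] wmax] := finite_set_max height (finite_word_orbit lam).
  by exists lam, [::].
exists w => i; rewrite leNgt; apply/negP => neg.
have := wmax _ (ex_intro _ (i :: w) erefl); rewrite /= /simple_reflection.
move: neg; move: (word_act A w lam) => nu neg.
rewrite heightBalpha gerDl oppr_le0 ler0z; lia.
Qed.

Variable pi : set (weight n).

Lemma weyl_orbitsP lam : weyl_orbits A pi lam <->
  exists2 mu, pi mu & exists w, lam = word_act A w mu.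
Proof.
split=> [[u [mu [/weylP[w ->] pmu ->]]]|[mu pmu [w ->]]]; first by exists mu => //; exists w.
by exists (word_act A w), mu; split=> //; apply/weylP; exists w.
Qed.

Lemma finite_weyl_orbits : finite_set pi -> finite_set (weyl_orbits A pi).
Proof.
move=> pi_fin.
have -> : weyl_orbits A pi = \bigcup_(mu in pi) [set lam | exists w, lam = word_act A w mu].
  by apply/seteqP; split=> lam => [/weyl_orbitsP[mu pmu h]|[mu pmu h]];
    [exists mu|apply/weyl_orbitsP; exists mu].
by apply: bigcup_finite => // mu _; exact: finite_word_orbit.
Qed.

Lemma weyl_orbits_dominant lam : saturated A pi ->
  weyl_orbits A pi lam -> dominant lam -> pi lam.
Proof.
move=> [pi_dom pi_sat] /weyl_orbitsP[mu pmu [w lamE]] lam0.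
apply: (pi_sat _ mu) => //; rewrite lamE.
case: hA => A2 Aneg [d [dval dA pos]].
have d_gt0 i : 0 < d i by have := dval i; rewrite !inE => /orP[/eqP->|/orP[]/eqP->].
apply: (word_act_le A2 Aneg d_gt0 dA); last exact: pi_dom.
move=> x x0; rewrite -(ltr0z rat).
have : exists i, (fun i => (x 0 i)%:~R : rat) i != 0.
  apply: contrapT => h; move/negP: x0; apply; apply/eqP/rowP => i; rewrite mxE.
  by apply/eqP; rewrite -(intr_eq0 rat); apply: contraT => xi; case: h; exists i.
move/pos; congr (_ < _); rewrite /root_norm /root_pair raddf_sum /=.
apply: eq_bigr => i _; rewrite mxE mulr_sumr raddf_sum /=.
by apply: eq_bigr => j _; rewrite !mxE !intrM; ring.
Qed.

End FiniteType.

(** * Representations of the three-dimensional simple Lie algebra *)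

Section AlgHorner.
Variables (R : ratAlgType) (x : R).

(** Evaluation of polynomials in an algebra which may be the zero ring. *)
Definition alg_horner (p : {poly rat}) : R := \sum_(i < size p) in_rat p`_i * x ^+ i.

Lemma alg_hornerEw m (p : {poly rat}) : (size p <= m)%N ->
  alg_horner p = \sum_(i < m) in_rat p`_i * x ^+ i.
Proof.
move=> le; rewrite /alg_horner (big_ord_widen _ (fun i => in_rat p`_i * x ^+ i) le).
rewrite [RHS](bigID (fun i : 'I_m => (i < size p)%N)) /= [X in _ + X]big1 ?addr0 // => i.
by rewrite -leqNgt => /(nth_default 0) ->; rewrite raddf0 mul0r.
Qed.

Lemma alg_horner_zmod : zmod_morphism alg_horner.
Proof.
move=> p q; pose m := maxn (size (p - q)) (maxn (size p) (size q)).
rewrite !(@alg_hornerEw m) ?leq_max ?leqnn ?orbT // -sumrB.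
by apply: eq_bigr => i _; rewrite coefB raddfB mulrBl.
Qed.

HB.instance Definition _ :=
  GRing.isZmodMorphism.Build {poly rat} R alg_horner alg_horner_zmod.

Lemma alg_hornerC q : alg_horner q%:P = in_rat q.
Proof. by rewrite (@alg_hornerEw 1) ?size_polyC ?leq_b1 // big_ord1 coefC mulr1. Qed.

Lemma alg_hornerMX (p : {poly rat}) : alg_horner (p * 'X) = alg_horner p * x.
Proof.
have le : (size (p * 'X)%R <= (size p).+1)%N.
  by apply: leq_trans (size_polyMleq _ _) _; rewrite size_polyX addn2.
rewrite (alg_hornerEw le) big_ord_recl coefMX /= raddf0 mul0r add0r mulr_suml.
by apply: eq_bigr => i _; rewrite coefMX /= -mulrA -exprSr.
Qed.

Lemma alg_hornerCM q (p : {poly rat}) : alg_horner (q%:P * p) = in_rat q * alg_horner p.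
Proof.
have le : (size (q%:P * p)%R <= size p)%N by rewrite mul_polyC size_scale_leq.
rewrite (alg_hornerEw le) mulr_sumr; apply: eq_bigr => i _.
by rewrite mul_polyC coefZ rmorphM mulrA.
Qed.

Lemma alg_horner_monoid : monoid_morphism alg_horner.
Proof.
split=> [|p q]; first by rewrite -polyC1 alg_hornerC rmorph1.
elim/poly_ind: q => [|q c IHq]; first by rewrite mulr0 raddf0 mulr0.
rewrite mulrDr mulrA !raddfD /= !alg_hornerMX IHq mulrDr mulrA; congr (_ + _).
by rewrite mulrC alg_hornerCM alg_hornerC in_ratC.
Qed.

HB.instance Definition _ :=
  GRing.isMonoidMorphism.Build {poly rat} R alg_horner alg_horner_monoid.

Lemma alg_hornerX : alg_horner 'X = x.
Proof. by rewrite -['X]mul1r alg_hornerMX rmorph1 mul1r. Qed.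

Lemma alg_horner_comm (y : R) p : y * x = x * y -> y * alg_horner p = alg_horner p * y.
Proof.
move=> xy; elim/poly_ind: p => [|p c IHp]; first by rewrite raddf0 mulr0 mul0r.
rewrite raddfD /= alg_hornerMX alg_hornerC mulrDr mulrDl mulrA IHp -!mulrA xy.
by rewrite in_ratC.
Qed.

(** If [x y = y (x + a)], moving [y] to the left translates polynomials in [x]. *)
Lemma alg_horner_shift (y : R) (a : rat) p : x * y = y * (x + in_rat a) ->
  alg_horner p * y = y * alg_horner (p \Po ('X + a%:P)).
Proof.
move=> xy; elim/poly_ind: p => [|p c IHp]; first by rewrite comp_poly0 raddf0 mulr0 mul0r.
rewrite comp_polyD comp_polyM comp_polyX comp_polyC !raddfD /= !rmorphM /=.
rewrite raddfD /= !alg_hornerX !alg_hornerC.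
by rewrite mulrDl mulrDr -mulrA xy mulrA IHp mulrA in_ratC.
Qed.

End AlgHorner.

Section Sl2Ring.
Variable R : ratAlgType.

(** The commutation relations with [h] are in the form which moves [h] to the
    right, where polynomials in [h] are collected. *)
Definition sl2_triple (e f h : R) : Prop :=
  [/\ h * e = e * (h + in_rat 2), h * f = f * (h + in_rat (-2)) & e * f = f * e + h].

(** This symmetry exchanges raising and lowering, so that half of the formulas
    suffice. *)
Lemma sl2_opp (e f h : R) : sl2_triple e f h -> sl2_triple f e (- h).
Proof.
move=> [he hf ef]; split.
- by rewrite mulNr hf -mulrN opprD -raddfN opprK.
- by rewrite mulNr he -mulrN opprD -raddfN.
- by rewrite ef addrK.
Qed.

Variables e f h : R.
Hypothesis T : sl2_triple e f h.

Local Notation ev := (alg_horner h).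
Local Notation c := (f * e).

Lemma sl2_e_shift p : ev p * e = e * ev (p \Po ('X + 2%:P)).
Proof. by case: T => he _ _; exact: alg_horner_shift. Qed.

Lemma sl2_f_shift p : ev p * f = f * ev (p \Po ('X + (-2)%:P)).
Proof. by case: T => _ hf _; exact: alg_horner_shift. Qed.

Lemma sl2_h_eX k : h * e ^+ k = e ^+ k * ev ('X + (2 * k%:R)%:P).
Proof.
elim: k => [|k IHk]; first by rewrite mul1r mulr0 addr0 alg_hornerX mulr1.
rewrite exprSr mulrA IHk -!mulrA sl2_e_shift; congr (_ * (_ * ev _)).
by rewrite comp_polyD comp_polyX comp_polyC -addrA -polyCD; congr (_ + _%:P); ring.
Qed.

(** The product [f e] is the Casimir element up to a polynomial in [h]; it will
    be denoted by [c]. *)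
Lemma sl2_casimir_comm : h * c = c * h.
Proof.
case: T => he hf _; rewrite mulrA hf -!mulrA; congr (_ * _).
by rewrite mulrDl he mulrDr in_ratC -addrA -mulrDr -raddfD subrr raddf0 mulr0 addr0.
Qed.

Lemma sl2_casimir_ev p : ev p * c = c * ev p.
Proof. by rewrite alg_horner_comm ?sl2_casimir_comm. Qed.

Lemma sl2_casimir_e k :
  c * e ^+ k = e ^+ k * (c - ev (k%:R%:P * ('X + (k%:R + 1)%:P))).
Proof.
case: T => he _ ef; elim: k => [|k IHk].
  by rewrite mul0r raddf0 subr0 mulr1 mul1r.
rewrite exprSr mulrA IHk -!mulrA; congr (_ * _).
have ce : c * e = e * (c - ev ('X + 2%:P)).
  rewrite mulrBr mulrA ef raddfD /= alg_hornerX alg_hornerC mulrDl -mulrA.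
  by rewrite he addrK.
rewrite mulrBl ce sl2_e_shift -mulrBr -addrA -opprD -raddfD; congr (_ * (_ - ev _)).
rewrite comp_polyM comp_polyD comp_polyX !comp_polyC -[k.+1]addn1 natrD.
by rewrite !polyCD; ring.
Qed.

Lemma sl2_eX_f m : e ^+ m.+1 * f =
  f * e ^+ m.+1 + e ^+ m * ev ((m%:R + 1)%:P * ('X + m%:R%:P)).
Proof.
case: T => he _ ef; elim: m => [|m IHm].
  by rewrite mulr0n add0r mul1r addr0 polyC1 mul1r alg_hornerX expr1.
rewrite exprS -mulrA IHm mulrDr mulrA ef mulrDl -mulrA -exprS -addrA; congr (_ + _).
rewrite mulrA -exprS sl2_h_eX -mulrDr -raddfD; congr (_ * ev _).
by rewrite -[m.+1]addn1 natrD !polyCD !polyCM; ring.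
Qed.

Lemma sl2_fe_recr k : f ^+ k.+1 * e ^+ k.+1 =
  f ^+ k * e ^+ k * (c - ev (k%:R%:P * ('X + (k%:R + 1)%:P))).
Proof. by rewrite exprSr [e ^+ _]exprS -mulrA [f * _]mulrA sl2_casimir_e mulrA. Qed.

Lemma sl2_fe_prod k : f ^+ k.+1 * e ^+ k.+1 =
  c * \prod_(i < k) (c - ev (i.+1%:R%:P * ('X + (i.+1%:R + 1)%:P))).
Proof.
elim: k => [|k IHk]; first by rewrite big_ord0 mulr1.
by rewrite sl2_fe_recr IHk big_ord_recr /= mulrA.
Qed.

End Sl2Ring.

Lemma alg_hornerN (R : ratAlgType) (h : R) p : alg_horner (- h) p = alg_horner h (p \Po (- 'X)).
Proof.
elim/poly_ind: p => [|p c IHp]; first by rewrite comp_poly0 !raddf0.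
rewrite comp_polyD comp_polyM comp_polyX comp_polyC !raddfD /= !rmorphM /= IHp.
by rewrite !alg_hornerC raddfN /= !alg_hornerX.
Qed.

Lemma sl2_ef_recr (R : ratAlgType) (e f h : R) k : sl2_triple e f h ->
  e ^+ k.+1 * f ^+ k.+1 =
  e ^+ k * f ^+ k * (f * e + alg_horner h ((k%:R + 1)%:P * ('X - k%:R%:P))).
Proof.
move=> T; rewrite (sl2_fe_recr (sl2_opp T)) alg_hornerN; case: T => _ _ ->.
rewrite -addrA; congr (_ * (_ + _)); rewrite -raddfN.
rewrite -{1}(alg_hornerX h) -raddfD; congr (alg_horner _ _).
rewrite comp_polyM comp_polyD comp_polyX !comp_polyC !polyCD; ring.
Qed.

Section RatModule.
Variables (R : ratAlgType) (V : lmodType R).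
Implicit Types (v w : V) (h : R) (p q : {poly rat}).

Lemma in_rat_scaleC (q : rat) (x : R) v : x *: (in_rat q *: v) = in_rat q *: (x *: v).
Proof. by rewrite !scalerA in_ratC. Qed.

Lemma in_rat_eq0 (q : rat) v : in_rat q *: v = 0 -> q != 0 -> v = 0.
Proof.
move=> h q0; rewrite -[v]scale1r -(rmorph1 in_rat) -(mulVf q0) rmorphM -scalerA h.
by rewrite scaler0.
Qed.

Lemma alg_horner_eigen h t p v : h *: v = in_rat t *: v ->
  alg_horner h p *: v = in_rat p.[t] *: v.
Proof.
move=> hv; elim/poly_ind: p => [|p c IHp]; first by rewrite horner0 !raddf0 !scale0r.
rewrite raddfD /= alg_hornerMX alg_hornerC !hornerE scalerDl -scalerA hv.
by rewrite in_rat_scaleC IHp scalerA raddfD /= scalerDl mulrC rmorphM.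
Qed.

Lemma alg_horner_coprime h p q v : coprimep p q ->
  alg_horner h p *: v = 0 -> alg_horner h q *: v = 0 -> v = 0.
Proof.
move=> /Bezout_eq1_coprimepP[[a b] /= ab] hp hq.
rewrite -[v]scale1r -(rmorph1 (alg_horner h)) -ab raddfD /= !rmorphM /=.
by rewrite scalerDl -!scalerA hp hq !scaler0 addr0.
Qed.

End RatModule.

(** A difference operator lowers the degree by one: it kills only constants, as
    a periodic polynomial takes one value infinitely often. *)
Lemma size_poly_diff (a : rat) (p : {poly rat}) : a != 0 -> (1 < size p)%N ->
  p \Po ('X + a%:P) - p != 0 /\ (size (p \Po ('X + a%:P) - p)%R < size p)%N.
Proof.
move=> a0 p1; have sX : size ('X + a%:P) = 2%N by rewrite size_XaddC.
split.
  rewrite subr_eq0; apply/eqP => pE.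
  have rootE k : (p - p.[0]%:P).[k%:R * a] = 0.
    elim: k => [|k IHk]; first by rewrite mul0r !hornerE subrr.
    have -> : (k.+1%:R * a) = ('X + a%:P).[k%:R * a].
      by rewrite !hornerE -[k.+1]addn1 natrD mulrDl mul1r.
    have E : p.[('X + a%:P).[k%:R * a]] = p.[k%:R * a] by rewrite -horner_comp pE.
    by move: IHk; rewrite !(hornerD p) !hornerN !hornerC E.
  have : p - p.[0]%:P = 0.
    apply: (@roots_geq_poly_eq0 _ _ [seq k%:R * a | k <- iota 0 (size p)]).
    - by apply/allP => _ /mapP[k _ ->]; apply/rootP.
    - rewrite map_inj_uniq ?iota_uniq // => k l /(mulIf a0) /eqP.
      by rewrite eqr_nat => /eqP.
    - rewrite size_map size_iota; apply: leq_trans (size_polyD _ _) _.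
      rewrite geq_max leqnn size_polyN (leq_trans (size_polyC_leq1 _)) //.
      exact: ltnW.
  move/eqP; rewrite subr_eq0 => /eqP pC; move: p1; rewrite pC ltnNge.
  by rewrite (leq_trans (size_polyC_leq1 _)).
have sp : (size p).-1.+1 = size p by case: (size p) p1.
rewrite -sp ltnS; apply/leq_sizeP => k; rewrite leq_eqVlt => /orP[/eqP <-|].
  rewrite coefB -/(lead_coef p).
  have -> : (size p).-1 = (size (p \Po ('X + a%:P))).-1 by rewrite size_comp_poly2.
  rewrite -lead_coefE lead_coef_comp ?sX // lead_coefXaddC expr1n mulr1.
  by rewrite subrr.
rewrite sp => pk; by rewrite coefB !nth_default ?subrr // size_comp_poly2.
Qed.

Section Sl2Module.
Variables (R : ratAlgType) (V : lmodType R).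
Implicit Types (v w : V) (p q : {poly rat}).

(** If [e^k q(h)] acts as zero then so does
    [e^(k+1) q(h + 2) = e^k q(h) e], hence [e^(k+1)] times the difference of
    [q(h + 2)] and [q(h)]; after finitely many steps [q] is a constant. *)
Lemma raising_nilpotent (e h : R) (p : {poly rat}) :
  h * e = e * (h + in_rat 2) -> p != 0 -> (forall v, alg_horner h p *: v = 0) ->
  exists N, forall v, e ^+ N *: v = 0.
Proof.
move=> he p0 pV.
suff [k]: exists k, forall v, e ^+ k *: (alg_horner h 1 *: v) = 0.
  by rewrite rmorph1 => h1; exists k => v; rewrite -(h1 v) scale1r.
suff H m : forall q k, (size q < m)%N -> q != 0 ->
    (forall v, e ^+ k *: (alg_horner h q *: v) = 0) ->
    exists k, forall v, e ^+ k *: (alg_horner h 1 *: v) = 0.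
  by apply: (H _ p 0%N (ltnSn _) p0) => v; rewrite pV scaler0.
elim: m => // m IHm q k qm q0 qV.
have [q1|q1] := leqP (size q) 1.
  move: q0 qV; rewrite (size1_polyC q1); set b := q`_0.
  rewrite polyC_eq0 => b0 qV; exists k => v; rewrite rmorph1 scale1r.
  by apply: (@in_rat_eq0 _ _ b) => //; rewrite -in_rat_scaleC -(qV v) alg_hornerC.
have [d0 ds] := @size_poly_diff 2 q isT q1.
apply: (IHm _ k.+1 (leq_trans ds qm) d0) => v.
rewrite raddfB scalerBl scalerBr [X in X - _](_ : _ = 0) ?sub0r.
  by rewrite exprS -scalerA qV scaler0 oppr0.
rewrite exprSr -scalerA [e *: _]scalerA.
by rewrite -(alg_horner_shift _ he) -scalerA qV.
Qed.

Variables e f h : R.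
Hypothesis T : sl2_triple e f h.
Local Notation ev := (alg_horner h).

Definition linear_product (s : seq rat) : {poly rat} := \prod_(t <- s) ('X - t%:P).

(** From [e^m g(h) = 0] one deduces [e^(m-1) (h + m - 1) g(h - 2) g(h) = 0] by
    commuting [e^m] with [f].  Starting with [e^N = 0], this leads to a
    polynomial in [h] with integral roots. *)
Lemma sl2_integral N : (forall v, e ^+ N *: v = 0) ->
  exists s : seq int, forall v, ev (linear_product (map intr s)) *: v = 0.
Proof.
move=> eN.
suff H m : (m <= N)%N -> exists s : seq int, forall v,
    e ^+ (N - m) *: (ev (linear_product (map intr s)) *: v) = 0.
  by have [s sP] := H N (leqnn _); exists s => v; rewrite -(sP v) subnn scale1r.
elim: m => [_|m IHm mN].
  by exists [::] => v; rewrite subn0 eN.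
have [s sP] := IHm (ltnW mN).
move: sP; rewrite -(subnSK mN); move: (N - m.+1)%N => k.
set g := linear_product _ => sP.
exists ((- k%:Z) :: [seq t + 2 | t <- s] ++ s) => v.
have -> : linear_product (map intr ((- k%:Z) :: [seq t + 2 | t <- s] ++ s)) =
    ('X + k%:R%:P) * ((g \Po ('X + (-2)%:P)) * g).
  rewrite /linear_product /= big_cons map_cat big_cat /=; congr (_ * (_ * _)).
    by rewrite raddfN /= polyCN opprK.
  rewrite rmorph_prod /= !big_map; apply: eq_bigr => t _.
  by rewrite comp_polyB comp_polyX comp_polyC polyCN rmorphD /= polyCD opprD addrA addrAC.
set g' := g \Po _.
apply: (@in_rat_eq0 _ _ (k%:R + 1)); last by rewrite natr1 pnatr_eq0.
set w := ev g *: v.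
have : e ^+ k.+1 *: (ev g *: (f *: w)) = 0 by [].
rewrite [ev g *: _]scalerA (sl2_f_shift T) -/g' -scalerA scalerA (sl2_eX_f T).
rewrite scalerDl -[(f * _) *: _]scalerA.
rewrite [ev g' *: w]scalerA -rmorphM mulrC rmorphM -[(ev g * _) *: _]scalerA sP scaler0 add0r.
move=> <-; rewrite -in_rat_scaleC -[RHS]scalerA; congr (_ *: _).
by rewrite !rmorphM /= alg_hornerC -!scalerA.
Qed.

Variable N : nat.
Hypothesis eN : forall v, e ^+ N *: v = 0.
Hypothesis fN : forall v, f ^+ N *: v = 0.

(** The classical formula for highest weight vectors, under the weaker condition
    [f e v = 0], which can be arranged for generalized eigenvectors of [h]. *)
Lemma sl2_highest k v : f *: (e *: v) = 0 ->
  e ^+ k *: (f ^+ k *: v) =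
  in_rat k`!%:R *: (ev (linear_product [seq i%:R | i <- iota 0 k]) *: v).
Proof.
elim: k v => [|k IHk] v cv.
  by rewrite /linear_product big_nil !rmorph1 !scale1r.
have cv' p : f *: (e *: (ev p *: v)) = 0.
  by rewrite !scalerA -(sl2_casimir_ev T) -!scalerA cv scaler0.
rewrite scalerA (sl2_ef_recr _ T) -!scalerA scalerDl -[(f * e) *: _]scalerA cv add0r.
have -> : linear_product [seq i%:R | i <- iota 0 k.+1] =
    linear_product [seq i%:R | i <- iota 0 k] * ('X - k%:R%:P).
  by rewrite -addn1 iotaD map_cat /linear_product big_cat /= big_seq1.
rewrite IHk // !(rmorphM ev) /= alg_hornerC factS mulnC natrM rmorphM /= -!scalerA.
by rewrite [in LHS]in_rat_scaleC -natr1.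
Qed.

Lemma linear_product_cons t s : linear_product (t :: s) = ('X - t%:P) * linear_product s.
Proof. by rewrite /linear_product big_cons. Qed.

Lemma linear_product_root s t : t \in s -> exists2 p, linear_product s = ('X - t%:P) * p &
  (uniq s -> p.[t] != 0).
Proof.
move=> ts; exists (linear_product (rem t s)).
  by rewrite /linear_product (perm_big _ (perm_to_rem ts)) big_cons.
move=> us; rewrite horner_prod prodf_seq_neq0; apply/allP => z /=.
by rewrite (mem_rem_uniq _ us) inE => /andP[zt _]; rewrite !hornerE subr_eq0 eq_sym.
Qed.

(** If there is no Jordan block of size 2 for the eigenvalue [j + 2] of [h], there is
    none for [j].  Let [(h - j)^2 v = 0] and [u = (h - j) v].  By assumption
    [(h - j - 2) e v = 0], that is [e u = 0]; if [u] is nonzero, the formula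
    for [e^N f^N u] shows that [j] is a natural number.  The formula for
    [f^(N+1) e^(N+1)] provides a polynomial [C] in [c] and [h] with [c C v = 0]
    and [C u] a nonzero multiple of [u].  Then [e^N f^N C v = 0] means that
    [h] satisfies on [C v] a polynomial with simple roots, so [(h - j) C v],
    a nonzero multiple of [u], vanishes. *)
Lemma sl2_jordan_step (j : rat) :
  (forall v, ev (('X - (j + 2)%:P) ^+ 2) *: v = 0 -> ev ('X - (j + 2)%:P) *: v = 0) ->
  forall v, ev (('X - j%:P) ^+ 2) *: v = 0 -> ev ('X - j%:P) *: v = 0.
Proof.
move=> good v v2; set u := ev _ *: v.
have shift : ('X - (j + 2)%:P) \Po ('X + 2%:P) = 'X - j%:P :> {poly rat}.
  by rewrite comp_polyB comp_polyX comp_polyC polyCD; ring.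
have eu : e *: u = 0.
  rewrite scalerA -shift -(sl2_e_shift T) -scalerA; apply: good.
  by rewrite scalerA (sl2_e_shift T) rmorphXn /= shift -scalerA v2 scaler0.
have hu : h *: u = in_rat j *: u.
  apply/eqP; rewrite -subr_eq0 -scalerBl -[h]alg_hornerX -(alg_hornerC h) -raddfB.
  by rewrite scalerA -rmorphM -expr2 v2.
apply: contrapT => u0.
have lead (p : {poly rat}) : ev p *: u = 0 -> p.[j] = 0.
  rewrite (alg_horner_eigen _ hu) => hp; apply/eqP; apply: contraT => pj.
  by case: u0; apply: in_rat_eq0 hp pj.
have cu : f *: (e *: u) = 0 by rewrite eu scaler0.
pose Q := linear_product [seq i%:R | i <- iota 0 N].
have Nf : (N`!%:R : rat) != 0 by rewrite pnatr_eq0 -lt0n fact_gt0.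
have kill w : f *: (e *: w) = 0 -> ev Q *: w = 0.
  move=> /(sl2_highest N); rewrite fN scaler0 => /esym hw.
  exact: in_rat_eq0 hw Nf.
have jN : j \in [seq i%:R | i <- iota 0 N].
  by rewrite -root_prod_XsubC; apply/rootP; apply: lead; exact: kill.
have [p QE pj] := linear_product_root jN.
have {}pj : p.[j] != 0.
  apply: pj; rewrite map_inj_uniq ?iota_uniq // => k l /eqP.
  by rewrite eqr_nat => /eqP.
have [i _ jE] := mapP jN.
pose F k := f * e - ev (k.+1%:R%:P * ('X + (k.+1%:R + 1)%:P)).
pose C k := \prod_(i < k) F i.
have Cev k q : ev q * C k = C k * ev q.
  apply: commr_prod => l _; apply: commrB; last first.
    by rewrite /GRing.comm -!rmorphM mulrC.
  exact: sl2_casimir_ev.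
have [k k0 Cu] : exists2 k, k != 0 & C N *: u = in_rat k *: u.
  rewrite /C; elim: (N) => [|m [k k0 IHm]].
    by exists 1; rewrite ?oner_eq0 // big_ord0 rmorph1.
  exists (k * (- (m.+1%:R * (j + (m.+1%:R + 1))))).
    rewrite mulf_neq0 // oppr_eq0 mulf_neq0 ?pnatr_eq0 //.
    by rewrite jE natr1 -natrD pnatr_eq0 addnS.
  rewrite big_ord_recr /= -scalerA /F scalerBl -scalerA cu sub0r.
  rewrite (alg_horner_eigen _ hu) -scaleNr -raddfN in_rat_scaleC IHm scalerA -rmorphM.
  by rewrite !hornerE mulrC.
pose w := C N *: v.
have cw : f *: (e *: w) = 0.
  by rewrite !scalerA -(sl2_fe_prod T) exprS -!scalerA exprS -!scalerA eN !scaler0.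
have := kill _ cw; rewrite /Q QE mulrC rmorphM /= -scalerA /w [ev ('X - _) *: _]scalerA Cev.
rewrite -scalerA -/u Cu in_rat_scaleC (alg_horner_eigen _ hu) => h1.
by case: u0; apply: (in_rat_eq0 (in_rat_eq0 h1 k0) pj).
Qed.

(** Downward induction from [j + 2 k] for [k] so large that this is not a root. *)
Lemma sl2_jordan (s : seq int) (j : int) :
  (forall v, ev (linear_product (map intr s)) *: v = 0) ->
  forall v, ev (('X - j%:~R%:P) ^+ 2) *: v = 0 -> ev ('X - j%:~R%:P) *: v = 0.
Proof.
move=> sV.
pose good (z : rat) := forall v, ev (('X - z%:P) ^+ 2) *: v = 0 -> ev ('X - z%:P) *: v = 0.
have gap (z : rat) : z \notin map intr s -> good z.
  move=> zs v v2; suff -> : v = 0 by rewrite scaler0.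
  apply: (alg_horner_coprime _ (sV v) v2).
  rewrite coprimep_expr // coprimep_XsubC; apply/negP => /rootP.
  by move/eqP; rewrite -/(root _ _) root_prod_XsubC (negbTE zs).
have [k hk] : exists k : nat, (j + (2 * k%:Z))%:~R \notin map (intr : int -> rat) s.
  (* farther from j than every element of s *)
  exists (\sum_(t <- s) `|t - j|%N).+1; apply/negP => /mapP[t ts /eqP].
  rewrite eqr_int => /eqP tE.
  have : (`|t - j| <= \sum_(t <- s) `|t - j|)%N by rewrite (big_rem t) //= leq_addr.
  lia.
suff : good (j%:~R + 2 * k%:R - 2 * k%:R) by rewrite addrK.
have : (k <= k)%N by []; elim: {-2 3}k => [_|m IHm mk].
  rewrite mulr0 subr0; apply: gap.
  suff -> : j%:~R + 2 * k%:R = (j + (2 * k%:Z))%:~R :> rat by [].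
  by rewrite intrD intrM.
apply: sl2_jordan_step; have := IHm (ltnW mk); congr good.
by rewrite -[m.+1]addn1 natrD; ring.
Qed.

(** When a root is repeated, [sl2_jordan] removes one of its copies. *)
Lemma sl2_squarefree (s : seq int) v :
  (forall v, ev (linear_product (map intr s)) *: v = 0) ->
  ev (linear_product (map intr (undup s))) *: v = 0.
Proof.
move=> sV; have := sV v; elim: (s) v => [|j r IHr] v //; rewrite [map _ _]/= linear_product_cons mulrC.
rewrite rmorphM /= -scalerA => /IHr H; case: ifP => jr; last first.
  by rewrite [map _ _]/= linear_product_cons mulrC rmorphM /= -scalerA.
have jr' : (j%:~R : rat) \in map intr (undup r) by rewrite map_f // mem_undup.
have [p pE _] := linear_product_root jr'; move: H; rewrite pE.
rewrite scalerA -rmorphM /= mulrAC -expr2 rmorphM /= -scalerA => /(sl2_jordan sV).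
by rewrite scalerA -rmorphM.
Qed.

(** Among the vectors [f^k e^k v], the last nonzero one is an eigenvector of
    [c] for the eigenvalue [k (m + k + 1) >= 0].  On it [e^m f^m] acts as the product
    of the [k (m + k + 1) + (l + 1) (m - l)] for [l < m], which are positive.  This
    gives a nonzero vector of weight [-m] without decomposing the module. *)
Lemma sl2_reflect (m : nat) v : v != 0 -> h *: v = in_rat m%:R *: v ->
  exists k, f ^+ (m + k) *: (e ^+ k *: v) != 0.
Proof.
move=> v0 hv.
have [k kP kmin] : exists2 k, (f ^+ k * e ^+ k) *: v != 0 & (f ^+ k.+1 * e ^+ k.+1) *: v = 0.
  have : exists k, (f ^+ k * e ^+ k) *: v == 0 by exists N; rewrite -scalerA eN scaler0.
  move=> ex; case: (ex_minnP ex) => [[|k] /eqP kv kmin].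
    by move: kv v0; rewrite mul1r scale1r => ->; rewrite eqxx.
  by exists k => //; apply/negP => /kmin; rewrite ltnn.
exists k; rewrite exprD -scalerA [f ^+ k *: _]scalerA.
set w := (f ^+ k * e ^+ k) *: v in kP *.
have evcomm p : ev p * (f ^+ k * e ^+ k) = f ^+ k * e ^+ k * ev p.
  case: k {kP kmin w} => [|k]; first by rewrite !mulr1 mul1r.
  rewrite (sl2_fe_prod T); apply: commrM; first exact: sl2_casimir_ev.
  apply: commr_prod => l _; apply: commrB; last first.
    by rewrite /GRing.comm -!rmorphM mulrC.
  exact: sl2_casimir_ev.
have hw : h *: w = in_rat m%:R *: w.
  by rewrite scalerA -[h]alg_hornerX evcomm -scalerA alg_hornerX hv in_rat_scaleC.
have ccomm : f * e * (f ^+ k * e ^+ k) = f ^+ k * e ^+ k * (f * e).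
  case: k {kP kmin w evcomm hw} => [|k]; first by rewrite !mulr1 mul1r.
  rewrite (sl2_fe_prod T); apply: commrM; first by [].
  apply: commr_prod => l _; apply: commrB; first by [].
  by apply/esym; exact: sl2_casimir_ev.
have cw : (f * e) *: w = in_rat (k%:R * (m%:R + (k%:R + 1))) *: w.
  apply/eqP; rewrite -subr_eq0; apply/eqP.
  move: kmin; rewrite (sl2_fe_recr T) mulrBr scalerBl -ccomm -evcomm.
  by rewrite -[(f * e * _) *: _]scalerA -[(ev _ * _) *: _]scalerA -/w (alg_horner_eigen _ hw) !hornerE.
have [a a0 aE] : exists2 a : rat, a != 0 & (e ^+ m * f ^+ m) *: w = in_rat a *: w.
  have : (m <= m)%N by []; elim: {-2}m => [_|l IHl lm].
    by exists 1; rewrite ?oner_eq0 // mul1r rmorph1.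
  have [a a0 aE] := IHl (ltnW lm).
  exists (a * (k%:R * (m%:R + (k%:R + 1)) + (l%:R + 1) * (m%:R - l%:R))).
    rewrite mulf_neq0 // -natrB 1?ltnW // !natr1 -natrD -!natrM -natrD pnatr_eq0.
    by rewrite addn_eq0 !muln_eq0 /= subn_eq0 leqNgt lm andbF.
  rewrite (sl2_ef_recr _ T) -scalerA scalerDl cw (alg_horner_eigen _ hw) !hornerE.
  by rewrite -scalerDl -raddfD in_rat_scaleC aE scalerA -rmorphM mulrC.
apply: contraNN kP => /eqP fw; apply/eqP; apply: (in_rat_eq0 _ a0).
by rewrite -aE -scalerA fw scaler0.
Qed.

End Sl2Module.

(** * Submodules, subquotients and composition series *)

Section SubmoduleOfProp.
Variables (U : pzRingType) (V : lmodType U) (P : V -> Prop).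
Hypotheses (P0 : P 0) (PD : forall x y, P x -> P y -> P (x + y)).
Hypothesis PZ : forall a x, P x -> P (a *: x).

(** The closure proofs are part of the term, so that the structure of submodule is
    inferred from it. *)
Definition prop_submod (_ : P 0) (_ : forall x y, P x -> P y -> P (x + y))
  (_ : forall a x, P x -> P (a *: x)) : {pred V} := fun v => `[< P v >].

Lemma prop_submod_closed : GRing.subsemimod_closed (prop_submod P0 PD PZ).
Proof.
split; [split|]; first exact/asboolP.
  by move=> x y /asboolP Px /asboolP Py; apply/asboolP; exact: PD.
by move=> a x /asboolP Px; apply/asboolP; exact: PZ.
Qed.

HB.instance Definition _ := GRing.isSubmodClosed.Build U V
  (prop_submod P0 PD PZ) prop_submod_closed.

Lemma prop_submodE : exists N : submodClosed V, forall v, v \in N <-> P v.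
Proof.
by exists (GRing.SubmodClosed.clone U V (prop_submod P0 PD PZ) _) => v;
  split=> /asboolP.
Qed.

End SubmoduleOfProp.

Section FactorModule.
Variables (U : pzRingType) (V : lmodType U) (N M : submodClosed V).

Definition factor_class (x : submod N) : factor_mod N M :=
  \pi_(quotmod (@submod_trace U V N M)) x.

Lemma factor_classW (P : factor_mod N M -> Prop) :
  (forall x, P (factor_class x)) -> forall z, P z.
Proof. exact: quotmodW. Qed.

Lemma factor_classZ a x : factor_class (a *: x) = a *: factor_class x.
Proof. by rewrite [RHS]quotmod_scaleE. Qed.

Lemma factor_classD x y : factor_class (x + y) = factor_class x + factor_class y.
Proof. exact: quotmodD. Qed.

Lemma factor_class_eq x y : factor_class x = factor_class y <->
  submod_val x - submod_val y \in M.
Proof. by split=> [/quotmodP //|h]; apply/quotmodP. Qed.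

Lemma factor_class0 : factor_class 0 = 0.
Proof. by rewrite -(scale0r 0) factor_classZ scale0r. Qed.

Lemma factor_class_eq0 x : factor_class x = 0 <-> submod_val x \in M.
Proof.
have val0 : submod_val 0 = 0 :> V by [].
by rewrite -factor_class0; split=> [/factor_class_eq|h];
  [|apply/factor_class_eq]; rewrite val0 subr0.
Qed.

End FactorModule.

Section FiniteDimensional.
Variables (U : ratAlgType) (V : lmodType U).
Hypothesis fdV : finite_dimensional V.

(** Cayley-Hamilton for a matrix of [h] on a spanning family, which need not be a
    basis. *)
Lemma finite_dim_annihilator (h : U) :
  exists2 p : {poly rat}, p != 0 & forall v : V, alg_horner h p *: v = 0.
Proof.
have [s sP] := fdV; set d := size s.
(* the family is extended by the default value 0 so as to be nonempty *)
have span v : exists c : 'I_d.+1 -> rat, v = \sum_i (in_rat (c i) : U) *: s`_i.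
  have [c ->] := sP v; exists c; rewrite big_ord_recr /= [s`_d]nth_default //.
  by rewrite scaler0 addr0.
have [M0 M0P] := choice (fun i : 'I_d.+1 => span (h *: s`_i)).
pose M : 'M_d.+1 := \matrix_(i, j) M0 i j.
exists (char_poly M); first exact/monic_neq0/char_poly_monic.
have H p (i : 'I_d.+1) : alg_horner h p *: s`_i =
    \sum_j (in_rat (horner_mx M p i j) : U) *: s`_j.
  elim/poly_ind: p i => [|p c IHp] i.
    by rewrite !raddf0 scale0r big1 // => j _; rewrite mxE raddf0 scale0r.
  have -> : horner_mx M (p * 'X + c%:P) = horner_mx M p *m M + c%:M.
    by rewrite rmorphD rmorphM /= horner_mx_X horner_mx_C mulmxE.
  rewrite raddfD /= scalerDl mulrC rmorphM /= alg_hornerX -scalerA IHp alg_hornerC.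
  rewrite scaler_sumr.
  rewrite [X in _ = X](eq_bigr (fun j => in_rat ((horner_mx M p *m M) i j) *: s`_j +
      in_rat ((c%:M : 'M_d.+1) i j) *: s`_j)); last first.
    by move=> j _; rewrite mxE raddfD scalerDl.
  rewrite big_split /=; congr (_ + _); last first.
    rewrite (bigD1 i) //= mxE eqxx mulr1n big1 ?addr0 // => j ji.
    by rewrite mxE eq_sym (negbTE ji) mulr0n raddf0 scale0r.
  rewrite (eq_bigr (fun k => \sum_j in_rat (horner_mx M p i k * M k j) *: s`_j)).
    rewrite exchange_big /=; apply: eq_bigr => j _; rewrite mxE raddf_sum scaler_suml.
    by apply: eq_bigr.
  move=> k _; rewrite in_rat_scaleC M0P scaler_sumr; apply: eq_bigr => j _.
  by rewrite scalerA -rmorphM mxE.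
move=> v; have [c ->] := span v; rewrite scaler_sumr big1 // => i _.
rewrite in_rat_scaleC H Cayley_Hamilton big1 ?scaler0 // => j _.
by rewrite mxE raddf0 scale0r.
Qed.

Definition strict_chain (k : nat) (F : nat -> submodClosed V) : Prop :=
  forall i, (i < k)%N -> (forall v, v \in F i -> v \in F i.+1) /\
    exists2 v, v \in F i.+1 & v \notin F i.

Lemma strict_chain_mono k F i j : strict_chain k F -> (i <= j)%N -> (j <= k)%N ->
  forall v, v \in F i -> v \in F j.
Proof.
move=> cF; elim: j => [|j IHj]; first by rewrite leqn0 => /eqP ->.
rewrite leq_eqVlt => /orP[/eqP -> //|ij] jk v vi.
by have [+ _] := cF j jk; apply; apply: IHj => //; exact: ltnW.
Qed.

(** Vectors chosen in the successive differences of a strict chain are linearly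
    independent: in a linear relation, the last vector involved would be in the
    previous submodule. *)
Lemma strict_chain_bound : exists d, forall k F, strict_chain k F -> (k <= d)%N.
Proof.
have [s sP] := fdV; exists (size s) => k F cF; rewrite leqNgt; apply/negP => dk.
have ex (i : 'I_k) : exists w, w \in F i.+1 /\ w \notin F i.
  by have [_ [v]] := cF i (ltn_ord i); exists v.
have [w wP] := choice ex.
have [c cP] := choice (fun i => sP (w i)).
pose C : 'M[rat]_(k, size s) := \matrix_(i, j) c i j.
have : kermx C != 0.
  rewrite kermx_eq0 /row_free eqn_leq rank_leq_row /= -ltnNge.
  exact: leq_ltn_trans (rank_leq_col C) dk.
case/rowV0Pn => u /sub_kermxP uC u0.
have uw : \sum_i (in_rat (u 0 i) : U) *: w i = 0.
  rewrite (eq_bigr (fun i => \sum_(j < size s) (in_rat (u 0 i * C i j) : U) *: s`_j)).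
    rewrite exchange_big big1 //= => j _; rewrite -scaler_suml -raddf_sum.
    have /rowP/(_ j) := uC; rewrite !mxE => ->; by rewrite raddf0 scale0r.
  move=> i _; rewrite {1}cP scaler_sumr; apply: eq_bigr => j _.
  by rewrite scalerA -rmorphM mxE.
have [i ui] : exists i, u 0 i != 0.
  apply: contrapT => h; move/eqP: u0; apply; apply/rowP => i; rewrite mxE.
  by apply/eqP; apply: contraT => ui; case: h; exists i.
case: (@arg_maxnP _ i (fun i => u 0 i != 0) val ui) => m um mmax.
have [_ /negP] := wP m; apply.
rewrite -[w m]scale1r -(rmorph1 in_rat) -(mulVf um) rmorphM -scalerA; apply: rpredZ.
move: uw; rewrite (bigD1 m) //= => /eqP; rewrite addr_eq0 => /eqP ->.
rewrite -scaleN1r; apply: rpredZ; apply: rpred_sum => j jm.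
have [/eqP ->|uj] := boolP (u 0 j == 0); first by rewrite raddf0 scale0r rpred0.
apply: rpredZ; apply: (strict_chain_mono cF _ (ltnW (ltn_ord m)) (proj1 (wP j))).
by rewrite ltn_neqAle jm; exact: mmax.
Qed.

(** A strict chain of maximal length is a composition series, since a submodule
    of a factor that is neither zero nor everything could be inserted. *)
Lemma finite_dim_composition_series : exists c : composition_series V, True.
Proof.
pose full k (F : nat -> submodClosed V) := [/\ strict_chain k F,
  forall v, v \in F 0%N <-> v = 0 & forall v, v \in F k].
have [Z ZP] : exists Z : submodClosed V, forall v, v \in Z <-> v = 0.
  apply: prop_submodE => // [x y -> ->|a x ->]; [exact: addr0|exact: scaler0].
have [T TP] : exists T : submodClosed V, forall v, v \in T <-> True.
  by apply: prop_submodE.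
have ex : exists k, `[< exists F, full k F >].
  have [[v v0]|V0] := pselect (exists v : V, v != 0).
    exists 1%N; apply/asboolP; exists (fun i => if i is 0 then Z else T); split=> //.
    - case=> // _; split=> [w _|]; first exact/TP.
      by exists v; [exact/TP|apply/negP => /ZP/eqP; rewrite (negbTE v0)].
    - by move=> v'; apply/TP.
  exists 0%N; apply/asboolP; exists (fun=> Z); split=> // v; apply/ZP.
  by apply: contrapT => /eqP v0; apply: V0; exists v.
have [d dP] := strict_chain_bound.
have bd k : `[< exists F, full k F >] -> (k <= d)%N.
  by move=> /asboolP[F [cF _ _]]; exact: dP cF.
case: (ex_maxnP ex bd) => k /asboolP[F [cF F0 Fk]] kmax.
suff sF i : (i < k)%N -> simple_module (factor_mod (F i.+1) (F i)).
  by exists (@CompositionSeries U V k F F0 Fk (fun i ik => proj1 (cF i ik)) sF).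
move=> ik; have [incl [v vi1 vi]] := cF i ik; split.
  exists (factor_class (F i) (SubMod vi1)); apply/eqP => /factor_class_eq0.
  exact/negP.
move=> N.
have [N' N'P] : exists N' : submodClosed V, forall w,
    w \in N' <-> exists2 h : w \in F i.+1, factor_class (F i) (SubMod h) \in N & True.
  apply: prop_submodE.
  - exists (rpred0 _) => //; suff -> : factor_class (F i) (SubMod (rpred0 (F i.+1))) = 0.
      exact: rpred0.
    by apply/factor_class_eq0; exact: rpred0.
  - move=> x y [hx Nx _] [hy Ny _]; exists (rpredD hx hy) => //.
    suff -> : factor_class (F i) (SubMod (rpredD hx hy)) =
        factor_class (F i) (SubMod hx) + factor_class (F i) (SubMod hy) by exact: rpredD.
    by rewrite -factor_classD; apply/factor_class_eq; rewrite subrr rpred0.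
  - move=> a x [hx Nx _]; exists (rpredZ a hx) => //.
    suff -> : factor_class (F i) (SubMod (rpredZ a hx)) =
        a *: factor_class (F i) (SubMod hx) by exact: rpredZ.
    by rewrite -factor_classZ; apply/factor_class_eq; rewrite subrr rpred0.
have FN' w : w \in F i -> w \in N'.
  move=> wi; apply/N'P; exists (incl _ wi) => //.
  suff -> : factor_class (F i) (SubMod (incl w wi)) = 0 by exact: rpred0.
  exact/factor_class_eq0.
have N'F w : w \in N' -> w \in F i.+1 by move=> /N'P[].
have [[x xN' xF]|N'Fi] := pselect (exists2 x, x \in N' & x \notin F i); last first.
  left; elim/factor_classW => x xN; apply/factor_class_eq0.
  apply: contrapT => /negP xF; apply: N'Fi; exists (submod_val x) => //.
  by apply/N'P; exists (submod_valP x) => //; case: x xN {xF}.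
have [[y yF yN']|FN] := pselect (exists2 y, y \in F i.+1 & y \notin N'); last first.
  right; elim/factor_classW => -[y yF].
  have /N'P[h hN _] : y \in N'.
    by apply: contrapT => /negP yN'; apply: FN; exists y.
  by rewrite (bool_irrelevance yF h).
have : (k.+1 <= k)%N; last by rewrite ltnn.
apply: kmax; apply/asboolP.
exists (fun j => if (j <= i)%N then F j else if j == i.+1 then N' else F j.-1); split.
- move=> j jk; case: (ltngtP j i) => [ji|ij|->].
  + by apply: cF; exact: ltn_trans ji ik.
  + rewrite eqSS (gtn_eqF ij).
    have [->|ji1] := eqVneq j i.+1; first by split=> [w /N'F //|]; exists y.
    rewrite /=; case: j ij jk ji1 => // j ij jk ji1.
    exact: cF.
  + by rewrite eqxx; split=> //; exists x.
- by rewrite leq0n.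
- move=> w; rewrite leqNgt (leq_trans ik) //= eqSS.
  by rewrite gtn_eqF.
Qed.

End FiniteDimensional.

(** * Weights of modules over the enveloping algebra *)

Section RatSpan.
Variables (R : ratAlgType) (V : lmodType R) (I : Type) (b : I -> V).

Definition rat_span (v : V) : Prop :=
  exists l : seq (rat * I), v = \sum_(x <- l) (in_rat x.1 : R) *: b x.2.

Lemma rat_spanD x y : rat_span x -> rat_span y -> rat_span (x + y).
Proof. by move=> [l ->] [m ->]; exists (l ++ m); rewrite big_cat. Qed.

Lemma rat_spanZ (q : rat) x : rat_span x -> rat_span (in_rat q *: x).
Proof.
move=> [l ->]; exists [seq (q * x.1, x.2) | x <- l].
rewrite big_map scaler_sumr; apply: eq_bigr => y _ /=.
by rewrite scalerA -rmorphM.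
Qed.

Lemma rat_span_gen i : rat_span (b i).
Proof. by exists [:: (1, i)]; rewrite big_seq1 rmorph1 scale1r. Qed.

Lemma rat_span0 : rat_span 0.
Proof. by exists [::]; rewrite big_nil. Qed.

Lemma rat_span_sum (J : Type) (r : seq J) (F : J -> V) :
  (forall j, rat_span (F j)) -> rat_span (\sum_(j <- r) F j).
Proof. by move=> h; apply: big_ind => //; [exact: rat_span0|exact: rat_spanD]. Qed.

Lemma rat_span_act (a : R) : (forall i, rat_span (a *: b i)) ->
  forall v, rat_span v -> rat_span (a *: v).
Proof.
move=> h v [l ->]; rewrite scaler_sumr; apply: rat_span_sum => x.
by rewrite in_rat_scaleC; exact/rat_spanZ.
Qed.

End RatSpan.

Section Eigen.
Variables (R : ratAlgType) (V : lmodType R) (h : R).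

Lemma alg_horner_act_comm p q (v : V) :
  alg_horner h p *: (alg_horner h q *: v) = alg_horner h q *: (alg_horner h p *: v).
Proof. by rewrite !scalerA -!rmorphM mulrC. Qed.

(** Decomposition into eigenvectors: those produced are polynomials in [h] applied
    to [v], so they satisfy every condition on [v] that is stable under [h]. *)
Lemma eigen_sum (P : V -> Prop) (s : seq rat) (v : V) :
  P 0 -> (forall x y, P x -> P y -> P (x + y)) -> uniq s ->
  alg_horner h (linear_product s) *: v = 0 ->
  (forall t q, h *: (alg_horner h q *: v) = in_rat t *: (alg_horner h q *: v) -> t \in s ->
     P (alg_horner h q *: v)) -> P v.
Proof.
move=> P0 PD; elim: s v => [|j s IHs] v.
  by rewrite /linear_product big_nil rmorph1 scale1r => _ ->.
rewrite linear_product_cons /= => /andP[js us] hv H.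
have {}hv : alg_horner h ('X - j%:P) *: (alg_horner h (linear_product s) *: v) = 0.
  by rewrite scalerA -rmorphM.
have : coprimep (linear_product s) ('X - j%:P).
  by rewrite coprimep_XsubC root_prod_XsubC.
move=> /Bezout_eq1_coprimepP[[a b] /= ab].
have split_v : v = alg_horner h (b * ('X - j%:P)) *: v +
    alg_horner h (a * linear_product s) *: v.
  by rewrite -scalerDl -raddfD [b * _ + _]addrC ab /= rmorph1 scale1r.
rewrite split_v; apply: PD.
  apply: IHs us _ _ => [|t q].
    rewrite rmorphM /= -scalerA alg_horner_act_comm.
    rewrite [alg_horner h (linear_product s) *: _]alg_horner_act_comm.
    by rewrite hv scaler0.
  have -> : alg_horner h q *: (alg_horner h (b * ('X - j%:P)) *: v) =
      alg_horner h (q * (b * ('X - j%:P))) *: v by rewrite [in RHS]rmorphM -scalerA.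
  move=> ht ts; apply: H ht _.
  by rewrite inE ts orbT.
apply: (H j); last by rewrite mem_head.
apply/eqP; rewrite -subr_eq0 -scalerBl -[h in h - _]alg_hornerX -(alg_hornerC h) -raddfB /=.
by rewrite [alg_horner h (a * _)]rmorphM /= -scalerA (alg_horner_act_comm _ a) hv scaler0.
Qed.

End Eigen.

(** The enveloping algebra enters the theory of weights through these relations
    and this induction principle; its construction as a quotient of a free
    algebra stays out of the computations. *)
Record chevalley_system n (A : 'M[int]_n) (U : ratAlgType) := ChevalleySystem {
  chev_e : 'I_n -> U;
  chev_f : 'I_n -> U;
  chev_h : 'I_n -> U;
  chev_hh : forall i j, chev_h i * chev_h j = chev_h j * chev_h i;
  chev_ef : forall i j, chev_e i * chev_f j =
    chev_f j * chev_e i + (if i == j then chev_h i else 0);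
  chev_he : forall i j, chev_h i * chev_e j =
    chev_e j * (chev_h i + in_rat (A i j)%:~R);
  chev_hf : forall i j, chev_h i * chev_f j =
    chev_f j * (chev_h i + in_rat (- (A i j)%:~R));
  chev_ind : forall P : U -> Prop,
    (forall x y, P x -> P y -> P (x + y)) ->
    (forall q x, P x -> P (in_rat q * x)) -> P 1 ->
    (forall i x, P x -> P (chev_e i * x)) ->
    (forall i x, P x -> P (chev_f i * x)) ->
    (forall i x, P x -> P (chev_h i * x)) -> forall x, P x
}.

Section ChevalleyModules.
Variables (n : nat) (A : 'M[int]_n) (U : ratAlgType) (C : chevalley_system A U).

Local Notation alpha := (simple_root A).
Local Notation E := (chev_e C).
Local Notation F := (chev_f C).
Local Notation H := (chev_h C).

Section Weights.
Variable V : lmodType U.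
Implicit Types (v w : V) (lam mu : weight n).

Definition weight_vector lam v : Prop :=
  forall i, H i *: v = in_rat (lam 0 i)%:~R *: v.

Lemma weight_vector_e lam v j : weight_vector lam v ->
  weight_vector (lam + alpha j) (E j *: v).
Proof.
move=> hv i; rewrite scalerA chev_he -scalerA scalerDl hv -scalerDl -raddfD.
by rewrite in_rat_scaleC !mxE intrD.
Qed.

Lemma weight_vector_f lam v j : weight_vector lam v ->
  weight_vector (lam - alpha j) (F j *: v).
Proof.
move=> hv i; rewrite scalerA chev_hf -scalerA scalerDl hv -scalerDl -raddfD.
by rewrite in_rat_scaleC !mxE intrD intrN.
Qed.

Lemma weight_vector_eX lam v j k : weight_vector lam v ->
  weight_vector (lam + alpha j *+ k) (E j ^+ k *: v).
Proof.
move=> hv; elim: k => [|k IHk]; first by rewrite addr0 scale1r.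
by rewrite exprS mulrSr addrA -scalerA; exact: weight_vector_e.
Qed.

Lemma weight_vector_fX lam v j k : weight_vector lam v ->
  weight_vector (lam - alpha j *+ k) (F j ^+ k *: v).
Proof.
move=> hv; elim: k => [|k IHk]; first by rewrite subr0 scale1r.
by rewrite exprS mulrSr opprD addrA -scalerA; exact: weight_vector_f.
Qed.

End Weights.

(** A product of factors [(h_i - nu_i) / (lam_i - nu_i)], one for each [nu] in [s],
    with [i] such that [lam] and [nu] differ at [i]. *)
Lemma weight_separate (lam : weight n) (s : seq (weight n)) : lam \notin s ->
  exists u : U, forall V : lmodType U,
    (forall v : V, weight_vector lam v -> u *: v = v) /\
    forall nu (v : V), nu \in s -> weight_vector nu v -> u *: v = 0.
Proof.
elim: s => [_|nu s IHs].
  by exists 1 => V; split=> [v|//]; rewrite scale1r.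
rewrite inE negb_or => /andP[lnu /IHs[u uP]].
have [i li] : exists i, lam 0 i != nu 0 i.
  apply: contrapT => h; move/eqP: lnu; apply; apply/rowP => i.
  by apply/eqP; apply: contraT => li; case: h; exists i.
have li0 : (lam 0 i)%:~R - (nu 0 i)%:~R != 0 :> rat by rewrite subr_eq0 eqr_int.
exists (u * in_rat ((lam 0 i)%:~R - (nu 0 i)%:~R)^-1 * (H i - in_rat (nu 0 i)%:~R)) => V.
have [u1 u0] := uP V; split=> [v hv|mu v ms hv].
  rewrite -scalerA scalerBl hv -scalerBl -(rmorphB in_rat) scalerA -mulrA.
  rewrite -(rmorphM in_rat) mulVf // (rmorph1 in_rat) mulr1; exact: u1.
rewrite -scalerA scalerBl hv -scalerBl -(rmorphB in_rat).
move: ms; rewrite inE => /orP[/eqP ->|ms].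
  by rewrite subrr (rmorph0 in_rat) scale0r scaler0.
by rewrite -scalerA 2!in_rat_scaleC (u0 mu) // 2!scaler0.
Qed.

Section HighestWeight.
Variables (L : lmodType U) (lam : weight n) (v0 : L).
Hypotheses (hv0 : weight_vector lam v0) (ev0 : forall i, E i *: v0 = 0).
Hypothesis gen : forall w, exists u : U, w = u *: v0.

Definition f_word (w : seq 'I_n) : L := foldr (fun j y => F j *: y) v0 w.
Definition f_word_weight (w : seq 'I_n) : weight n := foldr (fun j mu => mu - alpha j) lam w.

Lemma f_word_weight_vector w : weight_vector (f_word_weight w) (f_word w).
Proof. by elim: w => //= j w; exact: weight_vector_f. Qed.

Lemma f_word_weight_le w : weight_le A (f_word_weight w) lam.
Proof.
elim: w => [|j w IHw] /=; first exact: weight_le_refl.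
apply: weight_le_trans IHw; exists (fun i => (i == j)).
rewrite opprB addrCA subrr addr0 (bigD1 j) //= eqxx big1 ?addr0 // => i.
by move/negbTE ->.
Qed.

(** The span of the [f]-words applied to the highest weight vector is stable under
    the [e_i], by induction on the word. *)
Lemma f_word_span (x : L) : rat_span f_word x.
Proof.
have Hspan i y : rat_span f_word y -> rat_span f_word (H i *: y).
  apply: rat_span_act => w; rewrite (f_word_weight_vector w i).
  exact/rat_spanZ/rat_span_gen.
have Fspan i y : rat_span f_word y -> rat_span f_word (F i *: y).
  by apply: rat_span_act => w; exact: (rat_span_gen f_word (i :: w)).
have Espan i y : rat_span f_word y -> rat_span f_word (E i *: y).
  apply: rat_span_act; elim=> [|j w IHw] /=; first by rewrite ev0; exact: rat_span0.
  rewrite scalerA chev_ef scalerDl -scalerA; apply: rat_spanD; first exact: Fspan.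
  case: (i == j); last by rewrite scale0r; exact: rat_span0.
  exact/Hspan/rat_span_gen.
have [u ->] := gen x; elim/(@chev_ind _ _ _ C): u => [u u' hu hu'|q u hu||i u hu|i u hu|i u hu].
- by rewrite scalerDl; exact: rat_spanD.
- by rewrite -scalerA; exact: rat_spanZ.
- by rewrite scale1r; exact: (rat_span_gen f_word [::]).
- by rewrite -scalerA; exact: Espan.
- by rewrite -scalerA; exact: Fspan.
- by rewrite -scalerA; exact: Hspan.
Qed.

(** Otherwise an element separating [mu] from the weights of the words involved in
    [x] would fix [x] and kill it. *)
Lemma highest_weight_le mu (x : L) : weight_vector mu x -> x != 0 -> weight_le A mu lam.
Proof.
move=> hx x0; have [l lE] := f_word_span x.
have [/mapP[[q w] _ ->]|ml] := boolP (mu \in [seq f_word_weight p.2 | p <- l]).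
  exact: f_word_weight_le.
have [u /(_ L) [u1 u0]] := weight_separate ml.
move/eqP: x0; case; rewrite -(u1 _ hx) lE scaler_sumr big1_seq // => p /= pl.
rewrite in_rat_scaleC (u0 (f_word_weight p.2)) ?scaler0 //.
  exact: (map_f (fun p => f_word_weight p.2) pl).
exact: f_word_weight_vector.
Qed.

End HighestWeight.

Hypothesis hA : cartan_finite_type A.

Lemma chev_sl2 i : sl2_triple (E i) (F i) (H i).
Proof.
have [A2 _ _] := hA; split.
- by rewrite chev_he A2.
- by rewrite chev_hf A2.
- by rewrite chev_ef eqxx.
Qed.

Section FiniteDimensionalModule.
Variable V : lmodType U.
Hypothesis fdV : finite_dimensional V.

Lemma ef_nilpotent i : exists N, (forall v : V, E i ^+ N *: v = 0) /\
  forall v : V, F i ^+ N *: v = 0.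
Proof.
have T := chev_sl2 i.
have [he _ _] := T; have [hf _ _] := sl2_opp T.
have [p p0 pV] := finite_dim_annihilator fdV (H i).
have [q q0 qV] := finite_dim_annihilator fdV (- H i).
have [a aV] := raising_nilpotent he p0 pV.
have [b bV] := raising_nilpotent hf q0 qV.
exists (a + b)%N; split=> v; first by rewrite exprD -scalerA aV.
by rewrite addnC exprD -scalerA bV.
Qed.

Lemma h_squarefree i : exists2 s : seq int, uniq s &
  forall v : V, alg_horner (H i) (linear_product (map intr s)) *: v = 0.
Proof.
have [N [eN fN]] := ef_nilpotent i; have T := chev_sl2 i.
have [s sV] := sl2_integral T eN.
exists (undup s); first exact: undup_uniq.
move=> v; exact: (sl2_squarefree T eN fN).
Qed.

(** Finite-dimensional modules are spanned by weight vectors: the [h_i] are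
    diagonalized one after the other, the eigenspaces of the previous ones being
    stable as the [h_i] commute. *)
Lemma weight_ind (P : V -> Prop) :
  P 0 -> (forall x y, P x -> P y -> P (x + y)) ->
  (forall lam v, weight_vector lam v -> P v) -> forall v, P v.
Proof.
move=> P0 PD PW.
(* descending induction on the number k of h_i already diagonalized *)
suff K k : (k <= n)%N -> forall (t : weight n) v,
    (forall i : 'I_n, (i < k)%N -> H i *: v = in_rat (t 0 i)%:~R *: v) -> P v.
  by move=> v; apply: (K 0%N _ 0).
move=> kn; rewrite -(subKn kn); elim: (n - k)%N => [|m IHm] t v hv.
  by apply: (PW t) => i; apply: hv; rewrite subn0.
have [mn|nm] := leqP n m; last first.
  have km : (n - m.+1 < n)%N by lia.
  pose j := Ordinal km.
  have [s us sV] := h_squarefree j.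
  apply: (@eigen_sum _ _ (H j) P (map intr s)) => //.
    by rewrite map_inj_uniq //; exact: intr_inj.
  move=> t' q hq /mapP[z _ zE]; rewrite {t'}zE in hq.
  apply: (IHm (\row_i (if i == j then z else t 0 i))) => i ik; rewrite mxE.
  have [-> //|ij] := eqVneq i j.
  rewrite scalerA alg_horner_comm; last exact: chev_hh.
  rewrite -scalerA hv ?in_rat_scaleC //.
  by move: ik ij; rewrite -val_eqE /=; lia.
by apply: (IHm t) => i ik; apply: hv; lia.
Qed.

(** According to the sign of [<alpha_i^vee, mu>], [f_i] or [e_i] plays the lowering
    role in [sl2_reflect]. *)
Lemma weight_reflect (mu : weight n) (v : V) i : weight_vector mu v -> v != 0 ->
  exists2 w : V, weight_vector (simple_reflection A i mu) w & w != 0.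
Proof.
move=> hv v0; have [N [eN fN]] := ef_nilpotent i; have T := chev_sl2 i.
have [m [Em|Em]] : exists m : nat, mu 0 i = m%:Z \/ mu 0 i = - m%:Z.
  by exists `|mu 0%R i|%N; lia.
- have [|k wk] := @sl2_reflect _ V _ _ _ T N eN m v v0; first by rewrite hv Em.
  exists (F i ^+ (m + k) *: (E i ^+ k *: v)) => //.
  have := weight_vector_fX i (m + k) (weight_vector_eX i k hv).
  congr weight_vector; rewrite /simple_reflection Em -[m%:Z]natz scaler_nat.
  by rewrite mulrnDr opprD addrA addrAC addrK.
- have [|k wk] := @sl2_reflect _ V _ _ _ (sl2_opp T) N fN m v v0.
    by rewrite scaleNr hv Em intrN (rmorphN in_rat) scaleNr opprK.
  exists (E i ^+ (m + k) *: (F i ^+ k *: v)) => //.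
  have := weight_vector_eX i (m + k) (weight_vector_fX i k hv).
  congr weight_vector; rewrite /simple_reflection Em scaleNr opprK -[m%:Z]natz scaler_nat.
  by rewrite mulrnDr addrA addrAC subrK.
Qed.

Lemma weight_word (mu : weight n) (v : V) w : weight_vector mu v -> v != 0 ->
  exists2 v' : V, weight_vector (word_act A w mu) v' & v' != 0.
Proof.
move=> hv v0; elim: w => [|i w [v' hv' v'0]] /=; first by exists v.
exact: weight_reflect hv' v'0.
Qed.

End FiniteDimensionalModule.

End ChevalleyModules.

Section EnvelopingModules.
Variables (n : nat) (A : 'M[int]_n).

Local Notation U := (Ualg A).
Local Notation E := (U_e A).
Local Notation H := (U_h A).

Definition U_f (i : 'I_n) : U := pgen (U_rel A) (inl (inr i)).
Local Notation F := U_f.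

Lemma U_hh_rel i j : H i * H j = H j * H i.
Proof.
exact: (etrans (esym (alg_piM _ _ _)) (etrans (pgen_rel (U_hh A i j)) (alg_piM _ _ _))).
Qed.

Lemma U_ef_rel i j : E i * F j = F j * E i + (if i == j then H i else 0).
Proof.
apply/eqP; rewrite addrC -subr_eq; apply/eqP.
apply: (etrans (esym (alg_pi_mulB _ _ _ _ _))); apply: (etrans (pgen_rel (U_ef A i j))).
by case: (i == j) => //; exact: rmorph0.
Qed.

Lemma U_he_rel i j : H i * E j = E j * (H i + in_rat (A i j)%:~R).
Proof.
apply/eqP; rewrite mulrDr addrC -in_ratC -subr_eq; apply/eqP.
apply: (etrans (esym (alg_pi_mulB _ _ _ _ _))); apply: (etrans (pgen_rel (U_he A i j))).
exact: alg_piM.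
Qed.

Lemma U_hf_rel i j : H i * F j = F j * (H i + in_rat (- (A i j)%:~R)).
Proof.
apply/eqP; rewrite mulrDr addrC -in_ratC -subr_eq; apply/eqP.
apply: (etrans (esym (alg_pi_mulB _ _ _ _ _))); apply: (etrans (pgen_rel (U_hf A i j))).
have -> : in_rat (- (A i j)%:~R) * F j = - (in_rat (A i j)%:~R * F j).
  by rewrite (rmorphN in_rat) (mulNr (in_rat _) (F j)).
exact: (etrans (alg_piN _ _) (congr1 -%R (alg_piM _ _ _))).
Qed.

Lemma U_ind (P : U -> Prop) :
  (forall x y, P x -> P y -> P (x + y)) -> (forall q x, P x -> P (in_rat q * x)) ->
  P 1 -> (forall i x, P x -> P (E i * x)) -> (forall i x, P x -> P (F i * x)) ->
  (forall i x, P x -> P (H i * x)) -> forall x, P x.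
Proof.
move=> PD PZ P1 PE PF PH; apply: presented_ind => // -[[i|i]|i] x;
  [exact: PE|exact: PF|exact: PH].
Qed.

Definition Ualg_chevalley : chevalley_system A U :=
  ChevalleySystem U_hh_rel U_ef_rel U_he_rel U_hf_rel U_ind.

Hypothesis hA : cartan_finite_type A.
Variable pi : set (weight n).
Hypothesis pi_sat : saturated A pi.

(** Move the weight to a dominant one by the Weyl group.  It is a weight of the
    factor at the first step of a composition series which contains the vector,
    so it lies below the highest weight of this factor, which is in [pi]. *)
Lemma belongs_weight (V : lmodType U) (mu : weight n) (v : V) :
  belongs_to pi V -> weight_vector Ualg_chevalley mu v -> v != 0 -> weyl_orbits A pi mu.
Proof.
move=> [fdV cV] hv v0.
have [w wdom] := word_dominant hA mu.
have [x hx x0] := weight_word hA fdV w hv v0.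
apply/weyl_orbitsP; exists (word_act A w mu); last first.
  by exists (rev w); rewrite (word_actK hA).
have [c _] := finite_dim_composition_series fdV.
have ex : exists k, (k <= cs_length c)%N && (x \in cs_term c k).
  by exists (cs_length c); rewrite leqnn cs_top.
case: (ex_minnP ex) => -[/andP[_ /cs_bottom xE]|k /andP[kc xk] kmin].
  by rewrite xE eqxx in x0.
have [lam lampi [_ [y [_ ey hy gy]]]] := cV c k kc.
apply: (pi_sat.2 _ lam) => //.
pose z := factor_class (cs_term c k) (SubMod xk).
have hy' : weight_vector Ualg_chevalley lam y by exact: hy.
apply: (@highest_weight_le _ _ _ Ualg_chevalley _ lam y hy' ey gy _ z).
  move=> i; rewrite -!factor_classZ; congr factor_class; apply: val_inj.
  exact: hx.
apply/eqP => /factor_class_eq0 /= xk'.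
by have := kmin k; rewrite xk' (ltnW kc) ltnn => /(_ isT).
Qed.

End EnvelopingModules.

(** * The relations of the generalized Schur algebra *)

Section Pullback.
Variables (A B : pzRingType) (phi : {rmorphism A -> B}).

Definition pullback (_ : {rmorphism A -> B}) : Type := B.

HB.instance Definition _ := GRing.Zmodule.on (pullback phi).

Definition pullback_scale (a : A) (b : pullback phi) : pullback phi :=
  phi a * (b : B).

Lemma pullback_scaleA a b v :
  pullback_scale a (pullback_scale b v) = pullback_scale (a * b) v.
Proof. by rewrite /pullback_scale rmorphM mulrA. Qed.

Lemma pullback_scale1 : left_id 1 pullback_scale.
Proof. by move=> v; rewrite /pullback_scale rmorph1 mul1r. Qed.

Lemma pullback_scaleDr : right_distributive pullback_scale +%R.
Proof. by move=> a v w; rewrite /pullback_scale [LHS]mulrDr. Qed.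

Lemma pullback_scaleDl v : {morph pullback_scale^~ v : a b / a + b}.
Proof. by move=> a b; rewrite /pullback_scale rmorphD [LHS]mulrDl. Qed.

HB.instance Definition _ := GRing.Zmodule_isLmodule.Build A (pullback phi)
  pullback_scaleA pullback_scale1 pullback_scaleDr pullback_scaleDl.

Definition pullback_mod : lmodType A := pullback phi.

Lemma pullback_scaleE a (v : pullback_mod) : a *: v = phi a * (v : B) :> B.
Proof. by []. Qed.

End Pullback.

Section SchurRelations.
Variables (n : nat) (A : 'M[int]_n) (ws : seq (weight n)).
Hypothesis ws_uniq : uniq ws.
Local Notation alpha := (simple_root A).

(** The relations of [S(pi)], with [ws] listing [W pi], in an algebra
    which will be [S(pi)] itself or [U/I].  With [idm] extended by 0
    outside [W pi], the commutation relations of the generators with the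
    idempotents hold for all weights, so that those for [1_lam e_i] and
    [1_lam f_i] follow from those for [e_i 1_lam] and [f_i 1_lam]. *)
Record schur_relations (B : ratAlgType) (e f : 'I_n -> B) (idm : weight n -> B) : Prop :=
  SchurRelations {
  schur_idm0 : forall lam, lam \notin ws -> idm lam = 0;
  schur_idmM : forall lam mu, idm lam * idm mu = if lam == mu then idm lam else 0;
  schur_sum : \sum_(lam <- ws) idm lam = 1;
  schur_e_idm : forall i mu, e i * idm mu = idm (mu + alpha i) * e i;
  schur_f_idm : forall i mu, f i * idm mu = idm (mu - alpha i) * f i;
  schur_ef : forall i j, e i * f j - f j * e i =
    if i == j then \sum_(lam <- ws) in_rat (lam 0 i)%:~R * idm lam else 0;
  schur_serre_e : forall i j, i != j -> serre_sum A e i j = 0;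
  schur_serre_f : forall i j, i != j -> serre_sum A f i j = 0
}.

Section Consequences.
Variables (B : ratAlgType) (e f : 'I_n -> B) (idm : weight n -> B).
Hypothesis SR : schur_relations e f idm.

Definition schur_h (idm : weight n -> B) (i : 'I_n) : B :=
  \sum_(lam <- ws) in_rat (lam 0 i)%:~R * idm lam.
Local Notation h := (schur_h idm).

Lemma schur_ext (x y : B) : (forall mu, x * idm mu = y * idm mu) -> x = y.
Proof.
move=> xy; rewrite -[x]mulr1 -[y]mulr1 -(schur_sum SR) !mulr_sumr.
by apply: eq_bigr => mu _.
Qed.

Lemma schur_h_idm i mu : h i * idm mu = in_rat (mu 0 i)%:~R * idm mu.
Proof.
rewrite /schur_h mulr_suml; have [mws|mws] := boolP (mu \in ws); last first.
  by rewrite (schur_idm0 SR) // mulr0 big1 // => lam _; rewrite mulr0.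
rewrite (bigD1_seq mu) //= -mulrA (schur_idmM SR) eqxx big1 ?addr0 // => lam lmu.
by rewrite -mulrA (schur_idmM SR) (negbTE lmu) mulr0.
Qed.

Lemma schur_hh i j : h i * h j = h j * h i.
Proof.
apply: schur_ext => mu; rewrite -!mulrA !schur_h_idm !mulrA -!in_ratC -!mulrA.
by rewrite !schur_h_idm !mulrA -!rmorphM mulrC.
Qed.

(** The [e_j] and [f_j] shift weights by [alpha_j] and [- alpha_j], which yields
    their commutation relations with the [h_i]. *)
Lemma schur_shift (x : B) (a : int) i (beta : weight n) :
  (forall mu, x * idm mu = idm (mu + beta) * x) -> beta 0 i = a ->
  h i * x - x * h i = in_rat a%:~R * x.
Proof.
move=> xidm ba; apply: schur_ext => mu; rewrite mulrBl -!mulrA schur_h_idm.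
have -> : h i * (x * idm mu) = in_rat ((mu + beta) 0 i)%:~R * (x * idm mu).
  by rewrite xidm !mulrA schur_h_idm.
have -> : x * (in_rat (mu 0 i)%:~R * idm mu) = in_rat (mu 0 i)%:~R * (x * idm mu).
  by rewrite !mulrA in_ratC.
by rewrite -mulrBl -(rmorphB in_rat) mxE ba intrD [_ + a%:~R]addrC addrK.
Qed.

Lemma schur_he i j : h i * e j - e j * h i = in_rat (A i j)%:~R * e j.
Proof. by apply: (schur_shift (schur_e_idm SR j)); rewrite mxE. Qed.

Lemma schur_hf i j : h i * f j - f j * h i = - (in_rat (A i j)%:~R * f j).
Proof.
rewrite -[RHS]mulNr -(rmorphN in_rat) -intrN.
by apply: (schur_shift (schur_f_idm SR j)); rewrite !mxE.
Qed.

Lemma schur_fX_idm i k mu : f i ^+ k * idm mu = idm (mu - alpha i *+ k) * f i ^+ k.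
Proof.
elim: k => [|k IHk]; first by rewrite subr0 mulr1 mul1r.
by rewrite exprS -mulrA IHk mulrA (schur_f_idm SR) -mulrA mulrSr opprD addrA.
Qed.

End Consequences.
End SchurRelations.

Section UniversalProperties.
Variables (n : nat) (A : 'M[int]_n).

Lemma Ualg_lift (B : ratAlgType) (e f h : 'I_n -> B) :
  (forall i j, h i * h j = h j * h i) ->
  (forall i j, e i * f j - f j * e i = if i == j then h i else 0) ->
  (forall i j, h i * e j - e j * h i = in_rat (A i j)%:~R * e j) ->
  (forall i j, h i * f j - f j * h i = - (in_rat (A i j)%:~R * f j)) ->
  (forall i j, i != j -> serre_sum A e i j = 0) ->
  (forall i j, i != j -> serre_sum A f i j = 0) ->
  exists phi : {rmorphism Ualg A -> B},
    [/\ forall q, phi (in_rat q) = in_rat q, forall i, phi (U_e A i) = e i,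
      forall i, phi (U_f A i) = f i & forall i, phi (U_h A i) = h i].
Proof.
move=> hh ef he hf se sf.
pose t (g : U_gen n) : B :=
  match g with inl (inl i) => e i | inl (inr i) => f i | inr i => h i end.
have tE i : free_eval t (free_U_e i) = e i by exact: free_eval_gen.
have tF i : free_eval t (free_U_f i) = f i by exact: free_eval_gen.
have tH i : free_eval t (free_U_h i) = h i by exact: free_eval_gen.
have evM x y a b : free_eval t x = a -> free_eval t y = b -> free_eval t (x * y) = a * b.
  by move=> <- <-; exact: free_evalM.
have tR x y : U_rel A x y -> free_eval t x = free_eval t y.
  case=> {x y} [i j|i j|i j|i j|i j ij|i j ij].
  - apply: (etrans (evM _ _ _ _ (tH i) (tH j))); rewrite hh.
    exact: (esym (evM _ _ _ _ (tH j) (tH i))).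
  - rewrite free_eval_mulB tE tF ef; case: (i == j); first by rewrite tH.
    by rewrite rmorph0.
  - by rewrite free_eval_mulB tH tE he free_evalM free_eval_in_rat tE.
  - rewrite free_eval_mulB tH tF hf [RHS]rmorphN; congr (- _).
    by rewrite [RHS]free_evalM free_eval_in_rat tF.
  - rewrite [RHS]rmorph0 [LHS]rmorph_serre_sum -(se _ _ ij).
    by congr serre_sum; apply/funext => k /=; rewrite tE.
  - rewrite [RHS]rmorph0 [LHS]rmorph_serre_sum -(sf _ _ ij).
    by congr serre_sum; apply/funext => k /=; rewrite tF.
exists (presented_lift tR : {rmorphism _ -> _}); split=> [q|i|i|i].
- exact: presented_lift_in_rat.
- exact: presented_lift_gen.
- exact: presented_lift_gen.
- exact: presented_lift_gen.
Qed.

Lemma Ualg_serre_e i j : i != j -> serre_sum A (U_e A) i j = 0.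
Proof.
move=> ij; have := pgen_rel (U_serre_e A ij).
rewrite [alg_pi _ 0]rmorph0 => <-; exact: (esym (rmorph_serre_sum _ (alg_pi _) _ _ _)).
Qed.

Lemma Ualg_serre_f i j : i != j -> serre_sum A (@U_f n A) i j = 0.
Proof.
move=> ij; have := pgen_rel (U_serre_f A ij).
rewrite [alg_pi _ 0]rmorph0 => <-; exact: (esym (rmorph_serre_sum _ (alg_pi _) _ _ _)).
Qed.

Lemma Ualg_hom_eq (B : ratAlgType) (phi psi : {rmorphism Ualg A -> B}) :
  (forall q, phi (in_rat q) = psi (in_rat q)) ->
  (forall i, phi (U_e A i) = psi (U_e A i)) ->
  (forall i, phi (U_f A i) = psi (U_f A i)) ->
  (forall i, phi (U_h A i) = psi (U_h A i)) -> phi =1 psi.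
Proof.
by move=> hq he hf hh; apply: presented_hom_eq => // -[[i|i]|i];
  [exact: he|exact: hf|exact: hh].
Qed.

Variables (pi : set (weight n)) (ws : seq (weight n)).
Hypotheses (ws_uniq : uniq ws) (wsP : weyl_orbits A pi = [set` ws]).

Local Notation W := (weyl_orbits A pi).
Local Notation S := (Salg A pi).
Local Notation alpha := (simple_root A).
Local Notation J := (relation_ideal (@S_rel n A pi)).

Lemma wsE lam : W lam <-> lam \in ws.
Proof. by rewrite wsP. Qed.

Lemma fsum_ws (R : pzRingType) (F : weight n -> R) :
  \sum_(lam \in W) F lam = \sum_(lam <- ws) F lam.
Proof. by move: wsP; move: W => T ->; apply: esym; exact: fsbig_seq. Qed.

Definition S_e (i : 'I_n) : S := pgen (@S_rel n A pi) (inl (inl i)).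
Definition S_f (i : 'I_n) : S := pgen (@S_rel n A pi) (inl (inr i)).
Definition S_idm (lam : weight n) : S := alg_pi J (free_S_idem A pi lam).

Lemma free_S_idem0 lam : lam \notin ws -> free_S_idem A pi lam = 0.
Proof.
move=> lws; rewrite /free_S_idem insubN //.
by apply/negP; rewrite inE => /wsE; exact/negP.
Qed.

Lemma free_S_idem_val (x : W) : free_S_idem A pi (val x) = free_gen (inr x).
Proof. by rewrite /free_S_idem valK. Qed.

Lemma Salg_relations : schur_relations A ws S_e S_f S_idm.
Proof.
have idm0 lam : lam \notin ws -> S_idm lam = 0.
  by move=> lws; rewrite /S_idm free_S_idem0 //; exact: rmorph0.
have in_ws lam : lam \in ws -> W lam by move/wsE.
have piM x y := esym (alg_piM J x y).
split=> [|lam mu||i mu|i mu|i j|i j ij|i j ij]; first exact: idm0.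
- have [lws|lws] := boolP (lam \in ws); last by rewrite idm0 // mul0r if_same.
  have [mws|mws] := boolP (mu \in ws); last first.
    rewrite [S_idm mu]idm0 // mulr0; case: eqP => // E.
    by move: mws; rewrite -E lws.
  apply: (etrans (piM _ _)); apply: (etrans (pgen_rel (S_idem (in_ws _ lws) (in_ws _ mws)))).
  by case: eqP => // _; exact: rmorph0.
- have := pgen_rel (S_one A pi); rewrite fsum_ws => E.
  apply: (etrans (etrans (esym _) E)); last exact: rmorph1.
  exact: (rmorph_sum (alg_pi J)).
- have [mws|mws] := boolP (mu \in ws).
    apply: (etrans (piM _ _)); apply: (etrans (pgen_rel (S_e_idem i (in_ws _ mws)))).
    exact: alg_piM.
  have [mws'|mws'] := boolP (mu + alpha i \in ws); last first.
    by rewrite (idm0 _ mws) (idm0 _ mws') (mulr0 (S_e i)) (mul0r (S_e i)).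
  apply: esym; apply: (etrans (piM _ _)).
  apply: (etrans (pgen_rel (S_idem_e i (in_ws _ mws')))).
  by rewrite addrK; exact: alg_piM.
- have [mws|mws] := boolP (mu \in ws).
    apply: (etrans (piM _ _)); apply: (etrans (pgen_rel (S_f_idem i (in_ws _ mws)))).
    exact: alg_piM.
  have [mws'|mws'] := boolP (mu - alpha i \in ws); last first.
    by rewrite (idm0 _ mws) (idm0 _ mws') (mulr0 (S_f i)) (mul0r (S_f i)).
  apply: esym; apply: (etrans (piM _ _)).
  apply: (etrans (pgen_rel (S_idem_f i (in_ws _ mws')))).
  by rewrite subrK; exact: alg_piM.
- apply: (etrans (esym (alg_pi_mulB J _ _ _ _))).
  apply: (etrans (pgen_rel (S_ef A pi i j))).
  case: (i == j); last exact: rmorph0.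
  rewrite fsum_ws; apply: (etrans (rmorph_sum (alg_pi J) _ _ _)).
  by apply: eq_bigr => lam _; exact: alg_piM.
- have := pgen_rel (S_serre_e A pi ij).
  rewrite [alg_pi _ 0]rmorph0 => <-; exact: (esym (rmorph_serre_sum _ (alg_pi J) _ _ _)).
- have := pgen_rel (S_serre_f A pi ij).
  rewrite [alg_pi _ 0]rmorph0 => <-; exact: (esym (rmorph_serre_sum _ (alg_pi J) _ _ _)).
Qed.

Lemma Salg_lift (B : ratAlgType) (e f : 'I_n -> B) (idm : weight n -> B) :
  schur_relations A ws e f idm ->
  exists psi : {rmorphism S -> B},
    [/\ forall q, psi (in_rat q) = in_rat q, forall i, psi (S_e i) = e i,
      forall i, psi (S_f i) = f i & forall lam, psi (S_idm lam) = idm lam].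
Proof.
move=> SR.
pose t (g : S_gen A pi) : B :=
  match g with inl (inl i) => e i | inl (inr i) => f i | inr x => idm (val x) end.
have tE i : free_eval t (free_S_e A pi i) = e i by exact: free_eval_gen.
have tF i : free_eval t (free_S_f A pi i) = f i by exact: free_eval_gen.
have tI lam : free_eval t (free_S_idem A pi lam) = idm lam.
  have [lws|lws] := boolP (lam \in ws); last first.
    by rewrite free_S_idem0 // (schur_idm0 SR) // [LHS]rmorph0.
  have Wl : lam \in W by rewrite inE; apply/wsE.
  rewrite -[lam]/(val (Sub lam Wl : W)) free_S_idem_val.
  exact: free_eval_gen.
have evM x y a b : free_eval t x = a -> free_eval t y = b -> free_eval t (x * y) = a * b.
  by move=> <- <-; exact: free_evalM.
have tR x y : S_rel x y -> free_eval t x = free_eval t y.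
  case=> {x y} [lam mu _ _||i j|i lam _|i lam _|i lam _|i lam _|i j ij|i j ij].
  - apply: (etrans (evM _ _ _ _ (tI lam) (tI mu))); rewrite (schur_idmM SR).
    by case: eqP => _; [rewrite tI|apply: esym; exact: rmorph0].
  - rewrite fsum_ws [LHS]rmorph_sum [RHS]rmorph1 -(schur_sum SR).
    by apply: eq_bigr => lam _; exact: tI.
  - rewrite free_eval_mulB tE tF (schur_ef SR); case: (i == j); last by rewrite [RHS]rmorph0.
    rewrite fsum_ws [RHS]rmorph_sum; apply: eq_bigr => lam _.
    by apply: esym; apply: evM; [exact: free_eval_in_rat|exact: tI].
  - apply: (etrans (evM _ _ _ _ (tE i) (tI lam))); rewrite (schur_e_idm SR).
    exact: (esym (evM _ _ _ _ (tI _) (tE i))).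
  - apply: (etrans (evM _ _ _ _ (tF i) (tI lam))); rewrite (schur_f_idm SR).
    exact: (esym (evM _ _ _ _ (tI _) (tF i))).
  - apply: (etrans (evM _ _ _ _ (tI lam) (tE i))).
    rewrite -[in LHS](subrK (alpha i) lam) -(schur_e_idm SR).
    exact: (esym (evM _ _ _ _ (tE i) (tI _))).
  - apply: (etrans (evM _ _ _ _ (tI lam) (tF i))).
    rewrite -[in LHS](addrK (alpha i) lam) -(schur_f_idm SR).
    exact: (esym (evM _ _ _ _ (tF i) (tI _))).
  - rewrite [RHS]rmorph0 [LHS]rmorph_serre_sum -(schur_serre_e SR ij).
    by congr serre_sum; apply/funext => k /=; rewrite tE.
  - rewrite [RHS]rmorph0 [LHS]rmorph_serre_sum -(schur_serre_f SR ij).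
    by congr serre_sum; apply/funext => k /=; rewrite tF.
exists (presented_lift tR : {rmorphism _ -> _}); split=> [q|i|i|lam].
- exact: presented_lift_in_rat.
- exact: presented_lift_gen.
- exact: presented_lift_gen.
- exact: (etrans (quot_lift_pi _ _) (tI lam)).
Qed.

Lemma Salg_ind (P : S -> Prop) :
  (forall x y, P x -> P y -> P (x + y)) -> (forall q x, P x -> P (in_rat q * x)) ->
  P 1 -> (forall i x, P x -> P (S_e i * x)) -> (forall i x, P x -> P (S_f i * x)) ->
  (forall lam x, P x -> P (S_idm lam * x)) -> forall x, P x.
Proof.
move=> PD PZ P1 PE PF PI; apply: presented_ind => // -[[i|i]|w] x Px;
  [exact: PE|exact: PF|].
have -> : pgen (@S_rel n A pi) (inr w) = S_idm (val w); last exact: PI.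
by rewrite /S_idm free_S_idem_val.
Qed.

Lemma Salg_hom_eq (B : ratAlgType) (phi psi : {rmorphism S -> B}) :
  (forall q, phi (in_rat q) = psi (in_rat q)) ->
  (forall i, phi (S_e i) = psi (S_e i)) ->
  (forall i, phi (S_f i) = psi (S_f i)) ->
  (forall lam, phi (S_idm lam) = psi (S_idm lam)) -> phi =1 psi.
Proof.
move=> hq he hf hi; apply: presented_hom_eq => // -[[i|i]|w];
  [exact: he|exact: hf|].
have -> : pgen (@S_rel n A pi) (inr w) = S_idm (val w); last exact: hi.
by rewrite /S_idm free_S_idem_val.
Qed.

End UniversalProperties.

(** * The generalized Schur algebra as a module *)

Lemma finite_span_coef (R : ratAlgType) (V : lmodType R) (I : eqType) (b : I -> V)
    (T : seq I) (v : V) : (forall i, i \notin T -> b i = 0) -> rat_span b v ->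
  exists c : nat -> rat, v = \sum_(k < size (map b T)) (in_rat (c k) : R) *: (map b T)`_k.
Proof.
move=> bT [l ->]; elim: l => [|[q i] l [c IHl]].
  by exists (fun=> 0); rewrite big_nil big1 // => k _; rewrite (rmorph0 in_rat) scale0r.
rewrite big_cons IHl /=; have [iT|iT] := boolP (i \in T); last first.
  by exists c; rewrite bT // scaler0 add0r.
exists (fun k => (if k == index i T then q else 0) + c k).
have kT : (index i T < size (map b T))%N by rewrite size_map index_mem.
rewrite [RHS](eq_bigr (fun k : 'I_(size (map b T)) =>
    (if k == Ordinal kT then in_rat q *: b i else 0) + in_rat (c k) *: (map b T)`_k)).
  by rewrite big_split /= -big_mkcond big_pred1_eq.
move=> k _; rewrite (rmorphD in_rat) scalerDl -val_eqE /=; congr (_ + _).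
case: eqP => [->|_]; last by rewrite (rmorph0 in_rat) scale0r.
by rewrite (nth_map i) ?index_mem // nth_index.
Qed.

Fixpoint words_upto (n N : nat) : seq (seq 'I_n) :=
  if N is N'.+1 then [::] :: [seq i :: w | i <- enum 'I_n, w <- words_upto n N'] else [:: [::]].

Lemma words_uptoP n N (w : seq 'I_n) : (size w <= N)%N -> w \in words_upto n N.
Proof.
elim: N w => [|N IHN] [|i w] //= wN; rewrite inE //=.
by apply/allpairsP; exists (i, w); rewrite mem_enum IHN.
Qed.

Section SchurModule.
Variables (n : nat) (A : 'M[int]_n).
Hypothesis hA : cartan_finite_type A.
Variables (pi : set (weight n)) (ws : seq (weight n)).
Hypotheses (ws_uniq : uniq ws) (wsP : weyl_orbits A pi = [set` ws]).
Hypothesis pi_sat : saturated A pi.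
Variables (U : ratAlgType) (C : chevalley_system A U).
Variables (S : ratAlgType) (e f : 'I_n -> S) (idm : weight n -> S).
Hypothesis SR : schur_relations A ws e f idm.
Hypothesis S_ind : forall P : S -> Prop,
  (forall x y, P x -> P y -> P (x + y)) -> (forall q x, P x -> P (in_rat q * x)) ->
  P 1 -> (forall i x, P x -> P (e i * x)) -> (forall i x, P x -> P (f i * x)) ->
  (forall lam x, P x -> P (idm lam * x)) -> forall x, P x.
Variable phi : {rmorphism U -> S}.
Hypotheses (phi_rat : forall q, phi (in_rat q) = in_rat q)
  (phi_e : forall i, phi (chev_e C i) = e i) (phi_f : forall i, phi (chev_f C i) = f i)
  (phi_h : forall i, phi (chev_h C i) = schur_h ws idm i).

Local Notation alpha := (simple_root A).
Local Notation E := (chev_e C).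
Local Notation F := (chev_f C).
Local Notation H := (chev_h C).
Local Notation M := (pullback_mod phi).
Local Notation ht := (height A).

Lemma height_bound : exists N : nat, forall lam mu,
  lam \in ws -> mu \in ws -> (ht lam - ht mu < N%:R).
Proof.
have [B BP] : exists B : nat, forall lam, lam \in ws -> `|ht lam| < B%:R.
  elim: (ws) => [|lam s [B BP]]; first by exists 0%N.
  exists (B + Num.bound `|ht lam|)%N => mu; rewrite inE => /orP[/eqP ->|/BP h].
    rewrite natrD; apply: lt_le_trans (archi_boundP (normr_ge0 _)) _.
    by rewrite lerDr ler0n.
  by rewrite natrD; apply: lt_le_trans h _; rewrite lerDl ler0n.
exists (B + B)%N => lam mu /BP h1 /BP h2; rewrite natrD.
move: h1 h2; rewrite !ltr_norml => /andP[_ h1] /andP[h2 _].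
by apply: ltrD => //; rewrite ltrNl.
Qed.

(** The monomials of the triangular decomposition, without any choice of an
    order on the generators. *)
Definition spanning_word (t : seq 'I_n * weight n * seq 'I_n) : S :=
  foldr (fun i x => f i * x) (idm t.1.2 * foldr (fun i x => e i * x) 1 t.2) t.1.1.

Lemma e_word_idm w : exists nu, forall lam,
  idm lam * foldr (fun i x => e i * x) 1 w = foldr (fun i x => e i * x) 1 w * idm (lam - nu)
  /\ ht (lam - nu) = ht lam - (size w)%:R.
Proof.
elim: w => [|i w [nu IHw]] /=.
  by exists 0 => lam; rewrite !subr0 mulr1 mul1r.
exists (alpha i + nu) => lam; rewrite opprD addrA.
have [IH1 IH2] := IHw (lam - alpha i); split.
  by rewrite mulrA -[in LHS](subrK (alpha i) lam) -(schur_e_idm SR) -mulrA IH1 mulrA.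
rewrite IH2 (raddfB (height A)) /= (height_alpha hA) -addrA -opprD; congr (_ - _).
by rewrite [RHS]mulrS.
Qed.

Lemma f_word_idm w : exists nu, forall lam x,
  foldr (fun i x => f i * x) (idm lam * x) w = idm (lam - nu) * foldr (fun i x => f i * x) x w
  /\ ht (lam - nu) = ht lam - (size w)%:R.
Proof.
elim: w => [|i w [nu IHw]] /=.
  by exists 0 => lam x; rewrite !subr0.
exists (nu + alpha i) => lam x; rewrite opprD addrA.
have [IH1 IH2] := IHw lam x; split.
  by rewrite IH1 mulrA (schur_f_idm SR) mulrA.
rewrite (raddfB (height A)) /= (height_alpha hA) IH2 -addrA -opprD; congr (_ - _).
by rewrite addrC [RHS]mulrS.
Qed.

(** The span of the monomials is a left ideal containing 1.  In a nonzero monomial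
    the weights before and after each word are in [W pi], and their heights differ by the
    length of the word, which is therefore bounded. *)
Lemma schur_finite_dimensional : finite_dimensional M.
Proof.
have [N NP] := height_bound.
pose T := [seq (x, y) | x <- [seq (w, lam) | w <- words_upto n N, lam <- ws],
                        y <- words_upto n N].
have long lam mu w : ht mu = ht lam - (size w)%:R -> lam \in ws -> mu \in ws -> (size w <= N)%N.
  move=> hE lws mws; have := NP _ _ lws mws; rewrite hE opprB addrCA subrr addr0.
  by rewrite ltr_nat => /ltnW.
have spT t : t \notin T -> spanning_word t = 0.
  case: t => [[w lam] w'] tT; rewrite /spanning_word /=.
  have [lws|lws] := boolP (lam \in ws); last first.
    rewrite (schur_idm0 SR lws) mul0r; elim: w {tT} => //= i w ->; exact: mulr0.
  have [wN|wN] := boolP (size w <= N)%N; last first.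
    have [nu /(_ lam (foldr (fun i x => e i * x) 1 w'))[-> hE]] := f_word_idm w.
    rewrite (schur_idm0 SR) ?mul0r //; apply: contraNN wN; exact: long hE lws.
  have [wN'|wN'] := boolP (size w' <= N)%N; last first.
    have [nu /(_ lam)[-> hE]] := e_word_idm w'.
    rewrite (schur_idm0 SR (lam := lam - nu)) ?mulr0.
      by elim: w {tT wN} => //= i w ->; exact: mulr0.
    by apply: contraNN wN'; exact: long hE lws.
  case/negP: tT; apply/allpairsP; exists ((w, lam), w'); split=> //=; last exact: words_uptoP.
  by apply/allpairsP; exists (w, lam); rewrite words_uptoP.
pose b : seq 'I_n * weight n * seq 'I_n -> S^o := spanning_word.
have fS i x : rat_span b x -> rat_span b (f i * (x : S)).
  apply: (rat_span_act (a := f i)) => -[[w lam] w'].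
  exact: (rat_span_gen b (i :: w, lam, w')).
have idS lam x : rat_span b x -> rat_span b (idm lam * (x : S)).
  apply: (rat_span_act (a := idm lam)) => -[[w mu] w'].
  rewrite -[_ *: _]/(idm lam * _) /b /spanning_word /=.
  elim: w lam => [|i w IHw] lam /=.
    rewrite mulrA (schur_idmM SR); case: eqP => _; last by rewrite mul0r; exact: rat_span0.
    exact: (rat_span_gen b ([::], lam, w')).
  rewrite mulrA -[in idm lam](addrK (alpha i) lam) -(schur_f_idm SR) -mulrA.
  exact/fS/IHw.
have hS i x : rat_span b x -> rat_span b (schur_h ws idm i * (x : S)).
  move=> xs; rewrite /schur_h mulr_suml; apply: rat_span_sum => lam.
  rewrite -mulrA; apply: (rat_spanZ _ (idS lam x xs)).
have eS i x : rat_span b x -> rat_span b (e i * (x : S)).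
  apply: (rat_span_act (a := e i)) => -[[w mu] w'].
  rewrite -[_ *: _]/(e i * _) /b /spanning_word /=.
  elim: w => [|j w IHw] /=.
    rewrite mulrA (schur_e_idm SR) -mulrA.
    exact: (rat_span_gen b ([::], mu + alpha i, i :: w')).
  rewrite mulrA -[e i * f j](subrK (f j * e i)) (schur_ef SR) addrC mulrDl -mulrA.
  apply: rat_spanD; first exact/fS/IHw.
  case: (i == j); last by rewrite mul0r; exact: rat_span0.
  exact: (hS i _ (rat_span_gen b (w, mu, w'))).
have spanS (x : S) : rat_span b x.
  elim/S_ind: x => [x y|q x xs||i x|i x|lam x]; [exact: rat_spanD| |
    |exact: eS|exact: fS|exact: idS].
    exact: (rat_spanZ q xs).
  rewrite -(schur_sum SR); apply: rat_span_sum => lam.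
  have := rat_span_gen b ([::], lam, [::]).
  by rewrite /b /spanning_word /= mulr1.
exists (map b T : seq M) => v.
have [c cE] := @finite_span_coef S S^o _ b T v spT (spanS v).
exists c; rewrite [LHS]cE; apply: eq_bigr => k _.
by rewrite pullback_scaleE phi_rat.
Qed.

(** For surjective [phi], the modules over [U] that come from [S] by restriction. *)
Definition factors_through (V : lmodType U) : Prop :=
  forall u, phi u = 0 -> forall v : V, u *: v = 0.

Lemma factors_through_pullback : factors_through M.
Proof. by move=> u u0 v; rewrite [LHS]pullback_scaleE u0 mul0r. Qed.

Lemma factors_through_factor (V : lmodType U) (N K : submodClosed V) :
  factors_through V -> factors_through (factor_mod N K).
Proof.
move=> hV u u0; elim/factor_classW => x; rewrite -factor_classZ.
apply/factor_class_eq0; have -> : submod_val (u *: x) = u *: submod_val x by [].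
by rewrite (hV u u0) rpred0.
Qed.

Lemma pullback_idm_weight mu : @weight_vector n A U C M mu (idm mu).
Proof.
move=> i; rewrite [LHS]pullback_scaleE [RHS]pullback_scaleE.
by rewrite phi_h phi_rat (schur_h_idm ws_uniq SR).
Qed.

(** The action of [p lam] is prescribed on modules with weights in [ws]; there, it is
    the projection onto the weight space of [lam]. *)
Definition weight_projection (p : weight n -> U) : Prop :=
  (forall lam, lam \notin ws -> p lam = 0) /\
  forall lam (V : lmodType U) nu (v : V), lam \in ws -> nu \in ws ->
    weight_vector C nu v -> p lam *: v = if lam == nu then v else 0.

Lemma weight_projection_ex : exists p, weight_projection p.
Proof.
have ex lam : exists u : U, (lam \notin ws -> u = 0) /\
  forall (V : lmodType U) nu (v : V), lam \in ws -> nu \in ws ->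
    weight_vector C nu v -> u *: v = if lam == nu then v else 0.
  have [lws|lws] := boolP (lam \in ws); last by exists 0; split=> // V nu v.
  have : lam \notin rem lam ws by rewrite mem_rem_uniqF.
  move=> /(@weight_separate n A U C)[u uP]; exists u; split=> // V nu v _ nws hv.
  have [u1 u0] := uP V; case: eqVneq => [lE|lnu]; first by apply: u1; rewrite lE.
  by apply: (u0 nu) => //; rewrite mem_rem_uniq // inE eq_sym lnu.
have [p pP] := choice ex; exists p; split=> [lam|lam V nu v]; first exact: (pP lam).1.
exact: (pP lam).2.
Qed.

(** In [S] as a [U]-module, each [1_mu] has weight [mu], so that
    [p lam] maps the sum of the [1_mu], which is 1, to [1_lam]. *)
Lemma phi_projection p lam : weight_projection p -> phi (p lam) = idm lam.
Proof.
move=> [p0 p1]; have [lws|lws] := boolP (lam \in ws); last first.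
  by rewrite p0 // (rmorph0 phi) (schur_idm0 SR).
rewrite -[LHS]mulr1 -(schur_sum SR) mulr_sumr big_seq.
rewrite (eq_bigr (fun mu => if lam == mu then idm mu else 0)); last first.
  move=> mu mws; exact: (p1 lam M mu (idm mu) lws mws (pullback_idm_weight mu)).
rewrite -big_seq (bigD1_seq lam) //= eqxx big1 ?addr0 // => mu.
by rewrite eq_sym => /negbTE ->.
Qed.

Lemma factors_through_eq (V : lmodType U) x y (v : V) : factors_through V ->
  phi x = phi y -> x *: v = y *: v.
Proof.
move=> hV xy; apply/eqP; rewrite -subr_eq0 -scalerBl hV //.
by rewrite (rmorphB phi) xy subrr.
Qed.

(** Take a nonzero weight vector whose weight has maximal height; it is killed by the
    [e_i].  Since a power of [f_i] kills it too, the formula for [e_i^N f_i^N]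
    shows that its weight is dominant. *)
Lemma simple_factor_highest_weight (L : lmodType U) :
  factors_through L -> simple_module L ->
  exists2 lam, pi lam & exists v : L, [/\ v != 0, forall i, E i *: v = 0,
    weight_vector C lam v & forall w, exists u : U, w = u *: v].
Proof.
move=> hL [[y y0] simL]; have [p pP] := weight_projection_ex.
have pphi lam : phi (p lam) = idm lam by exact: phi_projection.
have pw lam (v : L) : weight_vector C lam (p lam *: v).
  move=> i; rewrite !scalerA; apply: factors_through_eq => //.
  by rewrite !(rmorphM phi) phi_h phi_rat pphi (schur_h_idm ws_uniq SR).
pose P := [set lam | lam \in ws /\ exists v : L, p lam *: v != 0].
have Pfin : finite_set P.
  apply: (@sub_finite_set _ _ [set` ws]) => [lam []//|]; exact: finite_seq.
have P0 : P !=set0.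
  apply: contrapT => hP; move/eqP: y0; apply.
  rewrite -[y]scale1r (@factors_through_eq L 1 (\sum_(lam <- ws) p lam)) //.
    rewrite scaler_suml big1_seq // => lam /= lws.
    by apply: contrapT => /eqP py; apply: hP; exists lam; split=> //; exists y.
  rewrite (rmorph1 phi) (rmorph_sum phi) -(schur_sum SR).
  by apply: eq_bigr => lam _; rewrite pphi.
have [lam [lws [v pv]] lmax] := finite_set_max ht Pfin P0.
set x := p lam *: v in pv.
have hx : weight_vector C lam x by exact: pw.
have ex i : E i *: x = 0.
  apply: contrapT => /eqP ex.
  have exE : E i *: x = p (lam + alpha i) *: (E i *: v).
    rewrite !scalerA; apply: factors_through_eq => //.
    by rewrite !(rmorphM phi) phi_e !pphi (schur_e_idm SR).
  have lws' : lam + alpha i \in ws.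
    apply: contraNT ex => nws; rewrite exE.
    by rewrite pP.1 // scale0r.
  have /lmax : P (lam + alpha i) by split=> //; exists (E i *: v); rewrite -exE.
  by rewrite (raddfD (height A)) /= (height_alpha hA) gerDl ler10.
have ldom : dominant lam.
  move=> i; have [N NP] := height_bound.
  have fx : F i ^+ N *: x = 0.
    rewrite scalerA (@factors_through_eq L _ 0) ?scale0r //.
    rewrite (rmorphM phi) (rmorphXn phi) phi_f pphi (rmorph0 phi) (schur_fX_idm SR).
    rewrite (schur_idm0 SR) ?mul0r //; apply/negP => lws'.
    have := NP _ _ lws lws'; rewrite (raddfB (height A)) (raddfMn (height A)) /=.
    by rewrite (height_alpha hA) opprB addrCA subrr addr0 ltxx.
  have := @sl2_highest _ _ _ _ _ (chev_sl2 C hA i) N x; rewrite ex scaler0 fx scaler0.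
  move=> /(_ erefl) /esym hl.
  have Nf : (N`!%:R : rat) != 0 by rewrite pnatr_eq0 -lt0n fact_gt0.
  have := in_rat_eq0 hl Nf; rewrite (alg_horner_eigen _ (hx i)) => hl'.
  have /rootP : (linear_product [seq i%:R | i <- iota 0 N]).[(lam 0 i)%:~R] = 0.
    by apply/eqP; apply: contraT => h0; move/eqP: pv; case; exact: in_rat_eq0 hl' h0.
  rewrite root_prod_XsubC => /mapP[k _ kE].
  by rewrite -(ler0z rat) kE ler0n.
exists lam.
  by apply: (weyl_orbits_dominant hA pi_sat) => //; rewrite wsP.
exists x; split=> //.
have [N NP] : exists N : submodClosed L, forall w, w \in N <-> exists u : U, w = u *: x.
  apply: prop_submodE => [|w w' [u ->] [u' ->]|a w [u ->]].
  - by exists 0; rewrite scale0r.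
  - by exists (u + u'); rewrite scalerDl.
  - by exists (a * u); rewrite scalerA.
case: (simL N) => [N0|N1] w; last exact/NP.
by move/eqP: pv; case; apply: N0; apply/NP; exists 1; rewrite scale1r.
Qed.

End SchurModule.

(** * Weight projections modulo the annihilator ideal *)

Section ProjectionRelations.
Variables (n : nat) (A : 'M[int]_n) (ws : seq (weight n)).
Hypothesis ws_uniq : uniq ws.
Variables (U : ratAlgType) (C : chevalley_system A U).
Local Notation E := (chev_e C).
Local Notation F := (chev_f C).
Local Notation H := (chev_h C).
Hypotheses (serre_e : forall i j, i != j -> serre_sum A E i j = 0)
  (serre_f : forall i j, i != j -> serre_sum A F i j = 0).
Variable modules : lmodType U -> Prop.
Hypothesis modules_weight : forall V, modules V -> forall nu (v : V),
  weight_vector C nu v -> v != 0 -> nu \in ws.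
Variables (B : ratAlgType) (theta : {rmorphism U -> B}).
Hypothesis theta_rat : forall q, theta (in_rat q) = in_rat q.
Hypothesis theta_eq : forall x y,
  (forall V, modules V -> forall nu (v : V), weight_vector C nu v -> nu \in ws ->
     x *: v = y *: v) -> theta x = theta y.
Variable p : weight n -> U.
Hypothesis pP : weight_projection ws C p.

Lemma projection_act (V : lmodType U) nu (v : V) lam : modules V -> weight_vector C nu v ->
  p lam *: v = if lam == nu then v else 0.
Proof.
move=> mV hv; have [->|v0] := eqVneq v 0; first by rewrite scaler0 if_same.
have nws := modules_weight mV hv v0; have [p0 p1] := pP.
have [lws|lws] := boolP (lam \in ws); first exact: p1.
rewrite p0 // scale0r; case: eqP => // lE.
by move: lws; rewrite lE nws.
Qed.

Lemma theta_h i : theta (H i) = schur_h ws (theta \o p) i.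
Proof.
have -> : schur_h ws (theta \o p) i = theta (\sum_(lam <- ws) in_rat (lam 0 i)%:~R * p lam).
  by rewrite (rmorph_sum theta); apply: eq_bigr => lam _; rewrite (rmorphM theta) theta_rat.
apply: theta_eq => V mV nu v hv nws; rewrite hv scaler_suml (bigD1_seq nu) //=.
rewrite -scalerA (projection_act _ mV hv) eqxx big1 ?addr0 // => lam lnu.
by rewrite -scalerA (projection_act _ mV hv) (negbTE lnu) scaler0.
Qed.

(** An equality after [theta] is tested on weight vectors, where [p lam] is a
    projection.  There, the relations between idempotents and generators say that the latter
    shift weights. *)
Lemma projection_relations :
  schur_relations A ws (theta \o E) (theta \o F) (theta \o p).
Proof.
split=> [lam lws|lam mu||i mu|i mu|i j|i j ij|i j ij].
- by rewrite /= pP.1 // (rmorph0 theta).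
- rewrite /= -(rmorphM theta).
  transitivity (theta (if lam == mu then p lam else 0)); last first.
    by case: eqP => // _; rewrite (rmorph0 theta).
  apply: theta_eq => V mV nu v hv nws; rewrite -scalerA (projection_act mu mV hv).
  have [->|lmu] := eqVneq lam mu.
    rewrite (projection_act mu mV hv); case: eqP => [mnu|_]; last by rewrite scaler0.
    by rewrite (projection_act mu mV hv) mnu eqxx.
  case: eqP => [mnu|_]; last by rewrite scaler0 scale0r.
  by rewrite (projection_act _ mV hv) -mnu (negbTE lmu) scale0r.
- rewrite -(rmorph_sum theta) -(rmorph1 theta); apply: theta_eq => V mV nu v hv nws.
  rewrite scaler_suml scale1r (bigD1_seq nu) //= (projection_act _ mV hv) eqxx.
  rewrite big1 ?addr0 // => lam lnu.
  by rewrite (projection_act _ mV hv) (negbTE lnu).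
- rewrite /= -!(rmorphM theta); apply: theta_eq => V mV nu v hv nws.
  rewrite -!scalerA (projection_act _ mV hv).
  rewrite (projection_act _ mV (weight_vector_e i hv)) (inj_eq (addIr _)).
  by case: eqP => // _; rewrite scaler0.
- rewrite /= -!(rmorphM theta); apply: theta_eq => V mV nu v hv nws.
  rewrite -!scalerA (projection_act _ mV hv).
  rewrite (projection_act _ mV (weight_vector_f i hv)) (inj_eq (addIr _)).
  by case: eqP => // _; rewrite scaler0.
- rewrite /= -!(rmorphM theta) -(rmorphB theta) chev_ef addrC addKr.
  by case: (i == j); [exact: theta_h|exact: rmorph0].
- have := congr1 theta (serre_e ij); rewrite rmorph_serre_sum => ->.
  exact: rmorph0.
- have := congr1 theta (serre_f ij); rewrite rmorph_serre_sum => ->.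
  exact: rmorph0.
Qed.

End ProjectionRelations.

Section DonkinIdeal.
Variables (n : nat) (A : 'M[int]_n) (pi : set (weight n)).
Hypothesis hA : cartan_finite_type A.
Local Notation U := (Ualg A).
Local Notation CU := (Ualg_chevalley A).

(** Finite-dimensional modules are spanned by weight vectors, so congruence
    modulo the annihilator ideal can be tested on them. *)
Lemma donkin_ideal_eq (x y : U) (ws : seq (weight n)) :
  (forall V, belongs_to pi V -> forall nu (v : V),
     weight_vector CU nu v -> v != 0 -> nu \in ws) ->
  (forall V, belongs_to pi V -> forall nu (v : V),
     weight_vector CU nu v -> nu \in ws -> x *: v = y *: v) ->
  alg_pi (donkin_ideal pi) x = alg_pi (donkin_ideal pi) y.
Proof.
move=> hws hxy; apply/alg_piP; apply/asboolP => V bV v.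
rewrite scalerBl; apply/eqP; rewrite subr_eq0; apply/eqP.
elim/(weight_ind (C := CU) hA bV.1): v => [|v w hv hw|nu v hv].
- by rewrite !scaler0.
- by rewrite !scalerDr hv hw.
- have [->|v0] := eqVneq v 0; first by rewrite !scaler0.
  by apply: (hxy V bV nu) => //; exact: (hws V bV nu v).
Qed.

(** [S(pi)], seen as a module over the enveloping algebra, is one of the
    modules whose annihilators define the ideal; since the ideal then kills
    [1], it is contained in the kernel of [phi]. *)
Lemma schur_belongs_to (ws : seq (weight n)) (phi : {rmorphism U -> Salg A pi}) :
  saturated A pi -> uniq ws -> weyl_orbits A pi = [set` ws] ->
  (forall q, phi (in_rat q) = in_rat q) ->
  (forall i, phi (U_e A i) = S_e A pi i) -> (forall i, phi (U_f A i) = S_f A pi i) ->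
  (forall i, phi (U_h A i) = schur_h ws (S_idm A pi) i) ->
  belongs_to pi (pullback_mod phi).
Proof.
move=> pi_sat ws_uniq wsP phi_rat phi_e phi_f phi_h.
have SRS := Salg_relations ws_uniq wsP; split.
  exact: (schur_finite_dimensional hA SRS (Salg_ind (A := A) (pi := pi)) phi_rat).
move=> c i ic.
have [|lam lampi [v [v0 ev hv gv]]] := simple_factor_highest_weight hA ws_uniq wsP pi_sat
  (C := CU) SRS phi_rat phi_e phi_f phi_h _ (cs_simple ic).
  exact/factors_through_factor/factors_through_pullback.
exists lam => //; split; first exact: cs_simple.
by exists v; split.
Qed.

End DonkinIdeal.

Theorem corollary6p13 (n : nat) (A : 'M[int]_n) (pi : set 'rV[int]_n)
  (hA : cartan_finite_type A) (pi_fin : finite_set pi)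
  (pi_sat : saturated A pi) :
  alg_isomorphic (Salg A pi) (generalized_schur_alg A pi).
Proof.
have [s0 s0E] := (finite_seqP _).1 (finite_weyl_orbits hA pi_fin).
pose ws := undup s0; have ws_uniq : uniq ws by exact: undup_uniq.
have wsP : weyl_orbits A pi = [set` ws].
  by rewrite s0E; apply/seteqP; split=> x /=; rewrite mem_undup.
have SRS := Salg_relations ws_uniq wsP.
have [phi [phi_rat phi_e phi_f phi_h]] := @Ualg_lift n A _ _ _ _
  (schur_hh ws_uniq SRS) (schur_ef SRS) (schur_he ws_uniq SRS) (schur_hf ws_uniq SRS)
  (schur_serre_e SRS) (schur_serre_f SRS).
have [p pP] := weight_projection_ex ws_uniq (Ualg_chevalley A).
have modW V (bV : belongs_to pi V) nu (v : V) :
    weight_vector (Ualg_chevalley A) nu v -> v != 0 -> nu \in ws.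
  by move=> hv v0; apply/(wsE wsP); exact: (belongs_weight hA pi_sat bV hv v0).
have theta_eq x y := @donkin_ideal_eq n A pi hA x y ws modW.
have theta_rat q : alg_pi (@donkin_ideal n A pi) (in_rat q) = in_rat q by [].
have SRB := projection_relations ws_uniq (C := Ualg_chevalley A) (@Ualg_serre_e n A)
  (@Ualg_serre_f n A) modW (theta := alg_pi (@donkin_ideal n A pi)) theta_rat theta_eq pP.
have [psi [psi_rat psi_e psi_f psi_idm]] := Salg_lift ws_uniq wsP SRB.
have ker_phi x : x \in @donkin_ideal n A pi -> phi x = 0.
  move=> /asboolP /(_ _ (schur_belongs_to hA pi_sat ws_uniq wsP phi_rat phi_e phi_f phi_h)).
  by move=> /(_ (1 : Salg A pi)); rewrite pullback_scaleE mulr1.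
pose chi : {rmorphism alg_quot (@donkin_ideal n A pi) -> Salg A pi} := quot_lift ker_phi.
have chi_pi x : chi (alg_pi (@donkin_ideal n A pi) x) = phi x by exact: quot_lift_pi.
(* Both composites of psi and chi are the identity, since they fix generators. *)
exists psi; split=> [q|]; first exact: psi_rat.
exists chi.
  apply: (@Salg_hom_eq n A pi _ (chi \o psi) idfun) => [q|i|i|lam] /=.
  - by rewrite psi_rat; exact: (etrans (chi_pi _) (phi_rat _)).
  - by rewrite psi_e; exact: (etrans (chi_pi _) (phi_e _)).
  - by rewrite psi_f; exact: (etrans (chi_pi _) (phi_f _)).
  - rewrite psi_idm; apply: (etrans (chi_pi _)).
    exact: (phi_projection (C := Ualg_chevalley A) ws_uniq SRS phi_rat phi_h lam pP).
elim/alg_piW => u; rewrite chi_pi.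
apply: (@Ualg_hom_eq n A _ (psi \o phi) (alg_pi (@donkin_ideal n A pi))) => [q|i|i|i] /=.
- by rewrite phi_rat psi_rat.
- by rewrite phi_e psi_e.
- by rewrite phi_f psi_f.
- rewrite phi_h; apply: (etrans _ (esym (theta_h ws_uniq modW (C := Ualg_chevalley A)
    (theta := alg_pi (@donkin_ideal n A pi)) theta_rat theta_eq pP i))).
  rewrite /schur_h; apply: (etrans (rmorph_sum psi _ _ _)).
  apply: eq_bigr => lam _; apply: (etrans (rmorphM psi _ _)).
  by rewrite psi_rat psi_idm.
Qed.
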